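(* Let $P$ be a law on environments $\omega=(\omega_x)_{x\in\mathbb Z}$ such that: (i) under $P$ the $\omega_x$, $x\in\mathbb Z$, are i.i.d. and there is a constant $c>0$ with $P(\omega_x\in[c,1-c])=1$; (ii) $P(\omega_0\ge 1/2)=1$ and $\alpha:=P(\omega_0=1/2)\in(0,1)$. Then for any $\beta<2$, $$\lim_{n\to\infty}P_\omega\Big(\max_{k\le 2n}|X_k|\ge \frac{n}{(\ln n)^\beta}\,\Big|\,X_{2n}=0\Big)=0,\qquad P\text{-a.s.},$$ and for any $\gamma<1$, $$\lim_{n\to\infty}P_\omega\Big(\max_{k\le 2n}|X_k|\ge n^\gamma\,\Big|\,X_{2n}=0\Big)=1,\qquad P\text{-a.s.}$$
   Context: An environment is $\omega=(\omega_x)_{x\in\mathbb Z}\in(0,1)^{\mathbb Z}$; $P$ is a probability law on environments. Given $\omega$, the random walk in random environment $(X_n)_{n\ge0}$ is, under the quenched law $P_\omega$, the time-homogeneous Markov chain on $\mathbb Z$ with $X_0=0$ that from site $x$ jumps to $x+1$ with probability $\omega_x$ and to $x-1$ with probability $1-\omega_x$. *)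

(* Defs.v *)
From HB Require Import structures.
From mathcomp Require Import all_boot all_order all_algebra.
From mathcomp Require Import all_classical all_reals all_analysis.

Set Implicit Arguments.
Unset Strict Implicit.
Unset Printing Implicit Defensive.

Import Order.TTheory GRing.Theory Num.Theory.
Import numFieldNormedType.Exports.

Local Open Scope classical_set_scope.
Local Open Scope ring_scope.

HB.instance Definition _ := isPointed.Build int 0.
HB.instance Definition _ := @isMeasurable.Build default_measure_display int
  discrete_measurable discrete_measurable0
  discrete_measurableC discrete_measurableU.

Record environment (R : realType) := Environment {
  site :> int -> R;
  site_in01 : forall x, 0 < site x < 1 }.

Lemma half_in01 (R : realType) (x : int) : 0 < (2^-1 : R) < 1.
Proof. by rewrite invr_gt0 ltr0n invf_lt1 ?ltr0n// ltr1n. Qed.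

HB.instance Definition _ (R : realType) := gen_eqMixin (environment R).
HB.instance Definition _ (R : realType) := gen_choiceMixin (environment R).
HB.instance Definition _ (R : realType) :=
  isPointed.Build (environment R) (Environment (@half_in01 R)).

Definition site_cylinders (R : realType) : set (set (environment R)) :=
  [set A | exists x (B : set R),
     measurable B /\ A = [set w : environment R | B (w x)]].

(* (0,1)^Z with the product sigma-algebra *)
Definition env_space (R : realType) := g_sigma_algebraType (@site_cylinders R).

Definition env_event (R : realType) (x : int) (B : set R) : set (env_space R) :=
  [set w : environment R | B (w x)].

Definition iid_sites (R : realType) (P : probability (env_space R) R) : Prop :=
  (forall (s : seq int) (B : int -> set R), uniq s ->
     (forall x, measurable (B x)) ->
     P [set w | forall x, x \in s -> env_event x (B x) w] =
     (\prod_(x <- s) P (env_event x (B x)))%E) /\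
  (forall (x y : int) (B : set R), measurable B ->
     P (env_event x B) = P (env_event y B)).

(* the value is 0 when [P B = 0] *)
Definition cond_prob d (T : measurableType d) (R : realType)
    (P : probability T R) (A B : set T) : R :=
  fine (P (A `&` B)) / fine (P B).

Definition step_prob (R : realType) (w : environment R) (x y : int) : R :=
  if y == x + 1 then w x else if y == x - 1 then 1 - w x else 0.

(* [X], defined on the probability space [(T, Q)], is a random walk in the fixed
   environment [w]; this determines the law of [X] under [Q], which is the
   quenched law P_w. *)
Definition quenched_walk (R : realType) (w : environment R)
    d (T : measurableType d) (Q : probability T R)
    (X : nat -> {mfun T >-> int}) : Prop :=
  Q [set t | X 0%N t = 0] = 1%E /\
  (forall (n : nat) (h : nat -> int) (y : int),
     let past := [set t | forall k, (k <= n)%N -> X k t = h k] in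
     (0 < Q past)%E ->
     cond_prob Q [set t | X n.+1 t = y] past = step_prob w (h n) y).

Definition max_abs d (T : measurableType d) (X : nat -> {mfun T >-> int})
    (m : nat) (t : T) : nat :=
  \max_(k < m.+1) `|X k t|%N.

(* Main.v *)
(* The numbers [p_2n(0,0)] are compared on the scale [S_n = n / (ln n)^2].

   Lower bound.  Almost surely [0, n^(1-eps)] contains a stretch of fair sites of
   length [l ~ ln n / |ln alpha|].  A cosine bump centred at the left end of this
   stretch is a subsolution with eigenvalue [cos (pi / 2l)]: left of the centre it
   increases, so the drift to the right only helps, and reaching the stretch costs
   [exp (- O (n^(1-eps) ln n))].  Hence [p_2n(0,0) >= cos (pi / 2l) ^ 2n * exp (- o (S_n))].

   Large displacements.  Almost surely every window of length of order [ln n] near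
   the origin contains a positive fraction of sites with a definite drift; by
   reversibility, visiting [z] and returning to 0 costs [exp (- c |z|)], and
   [n / (ln n)^beta] is much larger than [S_n].

   Small displacements.  A walk confined to [(-n^g, n^g)] only sees fair stretches
   of length [g ln n / |ln alpha|].  A positive supersolution of the form
   [u (x + 1) / u x = cos (phi + th) / cos phi], whose phase advances by [th] at each
   site and is contracted by a fixed factor at each drift site, shows that the
   confined return probability is at most [cos th ^ 2n], for [th] close to [pi / 2]
   divided by that length.  For [g < 1] this is smaller than the lower bound by a
   factor [exp (- c S_n)]. *)
Require Import Defs.
From HB Require Import structures.
From mathcomp Require Import all_boot all_order all_algebra.
From mathcomp Require Import all_classical all_reals all_analysis.
From mathcomp Require Import ring lra zify.
Set Implicit Arguments.
Unset Strict Implicit.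
Unset Printing Implicit Defensive.
Import Order.TTheory GRing.Theory Num.Theory.
Import numFieldNormedType.Exports.
Local Open Scope classical_set_scope.
Local Open Scope ring_scope.

(** * Kernels of nearest-neighbour chains on the integers *)

Fixpoint kern (R : realType) (a b : int -> R) (n : nat) (x y : int) : R :=
  if n is m.+1 then a x * kern a b m (x + 1) y + b x * kern a b m (x - 1) y
  else (x == y)%:R.

Section kern_theory.
Variables (R : realType) (a b : int -> R).
Implicit Types (n m : nat) (x y z : int) (u : int -> R).

Lemma kernS n x y :
  kern a b n.+1 x y = a x * kern a b n (x + 1) y + b x * kern a b n (x - 1) y.
Proof. by []. Qed.

(** [kern] is defined by its first step, while the law of the walk propagates by its last step; this
    form identifies the two. *)
Lemma kernSr n x y :
  kern a b n.+1 x y =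
  kern a b n x (y - 1) * a (y - 1) + kern a b n x (y + 1) * b (y + 1).
Proof.
elim: n x y => [|n IHn] x y; last first.
  by rewrite kernS [X in a x * X]IHn [X in b x * X]IHn !kernS; ring.
rewrite /= (_ : (x + 1 == y) = (x == y - 1)); last by rewrite -subr_eq ?opprK.
rewrite (_ : (x - 1 == y) = (x == y + 1)); last by rewrite -subr_eq ?opprK.
by congr (_ + _); case: eqVneq => [->|_]; rewrite ?mulr1 ?mulr0 ?mul1r ?mul0r.
Qed.

(** One-step balance passes to [n] steps by expanding one side at its first step and the other at
    its last. *)
Lemma kern_reversible (p : int -> R) n x y :
  (forall z, p z * a z = p (z + 1) * b (z + 1)) ->
  p x * kern a b n x y = p y * kern a b n y x.
Proof.
move=> pab; elim: n x y => [|n IHn] x y.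
  by rewrite /=; case: (eqVneq x y) => [->//|_]; rewrite !mulr0.
have pab' : p x * b x = p (x - 1) * a (x - 1).
  by have := pab (x - 1); rewrite subrK.
rewrite (kernSr n y x) kernS.
transitivity (b (x + 1) * (p (x + 1) * kern a b n (x + 1) y) +
              a (x - 1) * (p (x - 1) * kern a b n (x - 1) y)).
  by rewrite mulrDr (mulrA _ (a x)) (mulrA _ (b x)) pab pab'; ring.
by rewrite (IHn (x + 1)) (IHn (x - 1)); ring.
Qed.

Lemma kern_odd n x y : odd (`|x - y| + n) -> kern a b n x y = 0.
Proof.
elim: n x => [|n IHn] x /= xy.
  by case: eqVneq => // exy; move: xy; rewrite exy subrr.
by rewrite !IHn ?mulr0 ?addr0//; lia.
Qed.

Hypotheses (a0 : forall x, 0 <= a x) (b0 : forall x, 0 <= b x).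

Lemma kern_ge0 n x y : 0 <= kern a b n x y.
Proof.
elim: n x => [|n IHn] x /=; first by rewrite ler0n.
by rewrite addr_ge0// mulr_ge0.
Qed.

(** After [n] steps the expectation of [u] is at most [l ^+ n * u x]; the left side is a single term
    of it. *)
Lemma kern_supersolution u (l : R) n x y :
  0 <= l -> (forall z, 0 <= u z) ->
  (forall z, a z * u (z + 1) + b z * u (z - 1) <= l * u z) ->
  kern a b n x y * u y <= l ^+ n * u x.
Proof.
move=> l0 u0 uP; elim: n x => [|n IHn] x.
  by rewrite /= mul1r; case: eqVneq => [->|_]; rewrite ?mul1r ?mul0r.
rewrite /= mulrDl -!mulrA.
apply: (@le_trans _ _ (l ^+ n * (a x * u (x + 1) + b x * u (x - 1)))).
  rewrite mulrDr ![l ^+ n * (_ * _)]mulrCA.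
  by rewrite lerD// ler_wpM2l.
by rewrite exprSr -mulrA ler_wpM2l// exprn_ge0.
Qed.

Lemma kern_le1 n x y : (forall z, a z + b z <= 1) -> kern a b n x y <= 1.
Proof.
move=> ab; have := @kern_supersolution (fun=> 1) 1 n x y ler01.
by rewrite !mulr1 expr1n; apply=> // z; rewrite !mulr1.
Qed.

End kern_theory.

(** * Elementary inequalities for sine, cosine and tangent *)

Section trigonometric_bounds.
Variable R : realType.
Implicit Types x y t : R.

Lemma ge0_sin_le x : 0 <= x -> sin x <= x.
Proof.
move=> x0; have [|c _] := @MVT_segment R sin cos 0 x x0 (fun z _ => is_derive_sin z).
  by apply/continuous_subspaceT => z; exact: continuous_sin.
by rewrite sin0 !subr0 => ->; rewrite -[leRHS]mul1r ler_wpM2r// cos_le1.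
Qed.

Lemma cos_sub_ge x y t : x <= y -> {in `[x, y], forall z, t <= sin z} ->
  t * (y - x) <= cos x - cos y.
Proof.
move=> xy tP; have [|c cxy] := @MVT_segment R cos (fun z => - sin z) x y xy
    (fun z _ => is_derive_cos z).
  by apply/continuous_subspaceT => z; exact: continuous_cos.
rewrite -[cos x - cos y]opprB => ->; rewrite mulNr opprK.
by rewrite ler_wpM2r ?subr_ge0// tP.
Qed.

Lemma cos_homo x y : 0 <= x -> x <= y -> y <= pi -> cos y <= cos x.
Proof.
move=> x0 xy ypi; rewrite -subr_ge0 -[leLHS](mul0r (y - x)) cos_sub_ge//.
move=> z; rewrite in_itv/= => /andP[xz zy].
by rewrite sin_ge0_pi// (le_trans x0)// (le_trans zy).
Qed.

Lemma mul_cos_le_sin x : 0 <= x <= pi -> x * cos x <= sin x.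
Proof.
move=> /andP[x0 xpi].
have [|c] := @MVT_segment R sin cos 0 x x0 (fun z _ => is_derive_sin z).
  by apply/continuous_subspaceT => z; exact: continuous_sin.
rewrite in_itv/= sin0 !subr0 => /andP[c0 cx] ->.
by rewrite mulrC ler_wpM2r// cos_homo.
Qed.

Lemma cos_ge_quadratic x : 1 - x ^+ 2 / 2 <= cos x.
Proof.
wlog x0 : x / 0 <= x => [wlg|].
  have [/wlg//|/ltW x0] := leP 0 x.
  by have := wlg (- x); rewrite oppr_ge0 cosN sqrrN; apply.
have -> : x = (x / 2) *+ 2 by rewrite -mulr_natr divfK.
rewrite cos_mulr2n cos2sin2; set h := x / 2.
have h0 : 0 <= h by rewrite divr_ge0.
(* A negative sine forces [h > 1], because [pi >= 2]; then [sin h ^+ 2 <= 1 <= h ^+ 2] is enough. *)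
have [s|s] := leP 0 (sin h).
  have : sin h ^+ 2 <= h ^+ 2 by rewrite ler_sqr ?nnegrE// ge0_sin_le.
  lra.
have [h1|h1] := leP h 1.
  have : 0 <= sin h.
    by rewrite sin_ge0_pi// h0/= (le_trans h1)// (le_trans _ (pi_ge2 R))// ler1n.
  by rewrite leNgt s.
have := sin2cos2 h; have := sqr_ge0 (cos h); have : 1 <= h ^+ 2.
  by rewrite expr_ge1// ltW.
lra.
Qed.

Lemma half_le_sin x : 0 <= x <= 1 -> x / 2 <= sin x.
Proof.
move=> /andP[x0 x1]; have xpi : x <= pi.
  by rewrite (le_trans x1)// (le_trans _ (pi_ge2 R))// ler1n.
apply: le_trans (mul_cos_le_sin _); last by rewrite x0.
rewrite ler_wpM2l//; apply: le_trans (cos_ge_quadratic x).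
have : x ^+ 2 <= 1 by rewrite expr_le1.
lra.
Qed.

Lemma cos_gap x y : 0 <= x -> x <= y -> y <= 1 ->
  x / 2 * (y - x) <= cos x - cos y.
Proof.
move=> x0 xy y1; apply: cos_sub_ge => // z; rewrite in_itv/= => /andP[xz zy].
apply: (@le_trans _ _ (z / 2)); first by rewrite ler_wpM2r.
by apply: half_le_sin; rewrite (le_trans x0)// (le_trans zy).
Qed.

(** With [d = 1 - k] and denominators cleared, the claim is that [sin (d * y)], at most [d * y],
    does not exceed [(1 - rho) * sin y * cos (k * y)]. The latter is at least
    [(1 - rho) * cos Y ^+ 2 * y], which dictates the witness. *)
Lemma tan_contraction rho Y : 0 <= rho < 1 -> 0 <= Y < pi / 2 ->
  exists2 k, 0 <= k < 1 &
    forall y, 0 <= y <= Y -> rho * tan y <= tan (k * y).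
Proof.
move=> /andP[r0 r1] /andP[Y0 Ypi].
have pi0 := pi_gt0 R.
have cY : 0 < cos Y by apply: cos_gt0_pihalf; rewrite Ypi andbT; lra.
have cY1 := cos_le1 Y.
have d0 : 0 < (1 - rho) * cos Y ^+ 2 by rewrite mulr_gt0 ?exprn_gt0//; lra.
have d1 : (1 - rho) * cos Y ^+ 2 <= 1.
  by apply: mulr_ile1; rewrite ?exprn_ge0 ?exprn_ile1//; lra.
exists (1 - (1 - rho) * cos Y ^+ 2); first by apply/andP; split; lra.
set d := _ * cos Y ^+ 2 in d0 d1 *; move=> y /andP[y0 yY].
have kyy : (1 - d) * y <= y by rewrite ler_piMl//; lra.
have ky0 : 0 <= (1 - d) * y by rewrite mulr_ge0//; lra.
have cpos z : 0 <= z -> z <= Y -> cos Y <= cos z.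
  by move=> z0 zY; apply: cos_homo => //; lra.
have cy := lt_le_trans cY (cpos _ y0 yY).
have ck := lt_le_trans cY (cpos _ ky0 (le_trans kyy yY)).
have sy0 : 0 <= sin y by rewrite sin_ge0_pi// y0/=; lra.
rewrite /tan mulrA ler_pdivrMr// mulrAC ler_pdivlMr//.
have e : sin (d * y) = sin y * cos ((1 - d) * y) - cos y * sin ((1 - d) * y).
  by rewrite -sinB; congr sin; ring.
have sd : sin (d * y) <= d * y by rewrite ge0_sin_le// mulr_ge0// ltW.
have sy : y * cos Y <= sin y.
  apply: le_trans (mul_cos_le_sin _); last by rewrite y0/=; lra.
  by rewrite ler_wpM2l// cpos.
have : cos Y ^+ 2 * y <= sin y * cos ((1 - d) * y).
  rewrite (_ : cos Y ^+ 2 * y = (y * cos Y) * cos Y); last by ring.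
  apply: ler_pM => //; first by rewrite mulr_ge0// ltW.
  - exact: ltW.
  - by rewrite cpos// (le_trans kyy).
have r10 : 0 <= 1 - rho by lra.
move=> /(ler_wpM2l r10); rewrite mulrA -/d; lra.
Qed.

End trigonometric_bounds.

(** * From the law of the paths to transition kernels *)

Section walk_history.
Variables (R : realType) (w : environment R).
Variables (d : measure_display) (T : measurableType d) (Q : probability T R).
Variable X : nat -> {mfun T >-> int}.
Hypothesis XQ : quenched_walk w Q X.

(** Membership in the sigma-algebra of the first [n.+1] positions, stated pointwise; as positions
    are countable, this implies measurability. *)
Definition history_event (n : nat) (E : set T) : Prop :=
  forall t t', (forall k, (k <= n)%N -> X k t = X k t') -> E t -> E t'.

Lemma history_eventI n E F :
  history_event n E -> history_event n F -> history_event n (E `&` F).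
Proof. by move=> hE hF t t' tt' [/(hE _ _ tt') ? /(hF _ _ tt')]. Qed.

Lemma history_event_site n k y : (k <= n)%N -> history_event n [set t | X k t = y].
Proof. by move=> kn t t' /(_ _ kn) /= ->. Qed.

Lemma measurable_site k y : measurable [set t | X k t = y].
Proof.
rewrite -[X in measurable X]setTI.
exact: (@measurable_funP _ _ _ _ setT (X k) measurableT [set y]).
Qed.

(** Histories are numbered, so that sums over them become countable series. *)
Let code n (t : T) : nat := pickle [seq X k t | k <- iota 0 n.+1].

Let codeP n t t' : code n t = code n t' <-> forall k, (k <= n)%N -> X k t = X k t'.
Proof.
split=> [/(pcan_inj pickleK)/eq_in_map + k kn|tt'].
  by apply; rewrite mem_iota; lia.
by congr pickle; apply/eq_in_map => k; rewrite mem_iota => kn; apply: tt'; lia.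
Qed.

Let measurable_past n (h : nat -> int) :
  measurable [set t | forall k, (k <= n)%N -> X k t = h k].
Proof.
rewrite (_ : mkset _ = \bigcap_(k in [set k | (k <= n)%N]) [set t | X k t = h k])//.
by apply: bigcap_measurable; [exists 0%N | move=> k _; exact: measurable_site].
Qed.

Let code_fibre n E i : history_event n E ->
  (E `&` [set t | code n t = i] = set0) \/
  exists h, E `&` [set t | code n t = i] =
    [set t | forall k, (k <= n)%N -> X k t = h k] /\ E `&` [set t | code n t = i] !=set0.
Proof.
move=> hE; have [->|/set0P[t0 [Et0 t0i]]] := eqVneq (E `&` [set t | code n t = i]) set0.
  by left.
right; exists (X ^~ t0); split; last by exists t0.
apply/seteqP; split=> t /=.
  by move=> [_]; rewrite -t0i => /codeP.
move=> tt0; split; last by rewrite -t0i; apply/codeP.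
by apply: hE Et0 => k kn; rewrite tt0.
Qed.

Lemma measurable_history n E : history_event n E -> measurable E.
Proof.
move=> hE; have -> : E = \bigcup_i (E `&` [set t | code n t = i]).
  by rewrite -setI_bigcupr; apply/seteqP; split=> [t Et|t []//]; split=> //; exists (code n t).
apply: bigcup_measurable => i _.
by have [->|[h [-> _]]] := code_fibre i hE.
Qed.

Local Open Scope ereal_scope.

(* Countably many histories partition the space; on each of them the step
   probability is the one prescribed by [quenched_walk]. *)
Lemma history_step n E y s : history_event n E ->
  (forall t, E t -> step_prob w (X n t) y = s) ->
  Q (E `&` [set t | X n.+1 t = y]) = s%:E * Q E.
Proof.
move=> hE sE; pose F i := [set t | code n t = i].
have split_code A : measurable A -> Q A = \sum_(i <oo) Q (A `&` F i).
  move=> mA; have {1}-> : A = \bigcup_i (A `&` F i).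
    rewrite -setI_bigcupr; apply/seteqP; split=> [t At|t []//].
    by split=> //; exists (code n t).
  rewrite measure_bigcup//; first by apply: eq_eseriesl => // i; rewrite in_setT.
    move=> i _; apply: measurableI => //.
    by apply: (@measurable_history n) => t t' tt' /= <-; apply/esym/codeP.
  by apply/trivIsetP => i j _ _ ij; apply/seteqP; split=> // t [[_ ti] [_ tj]]; move: ij; rewrite -ti -tj eqxx.
have mE := measurable_history hE.
have mX := measurable_site n.+1 y.
rewrite (split_code _ (measurableI _ _ mE mX)) (split_code _ mE).
(* The series is scaled by a nonnegative [s], and [s] is a step probability only when [E] is
   inhabited. *)
have s0 : (0 <= s)%R \/ E = set0.
  have [->|/set0P[t Et]] := eqVneq E set0; [by right|left].
  rewrite -(sE _ Et) /step_prob; have /andP[w0 w1] := site_in01 w (X n t).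
  by case: ifP => _; [exact: ltW|case: ifP => _ //; rewrite subr_ge0 ltW].
case: s0 => [s0|->]; last first.
  rewrite !set0I; under eq_eseriesr do rewrite set0I measure0.
  by rewrite eseries0 ?mule0// => i _ _; rewrite set0I measure0.
rewrite -nneseriesZl//; apply: eq_eseriesr => i _.
rewrite setIAC; have [->|[h [eh [t0 Et0]]]] := code_fibre i hE.
  by rewrite set0I measure0 mule0.
have t0h : forall k, (k <= n)%N -> X k t0 = h k by rewrite eh in Et0.
rewrite eh; set past := mkset _.
have mp : measurable past by exact: measurable_past.
(* [quenched_walk] is silent on histories of probability 0; there both sides vanish. *)
have [p0|p0] := eqVneq (Q past) 0.
  rewrite p0 mule0; apply/eqP; rewrite eq_le measure_ge0 andbT -p0.
  by rewrite le_measure ?inE//; exact: measurableI.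
have Qp : 0 < Q past by rewrite lt0e p0 measure_ge0.
have : cond_prob Q [set t | X n.+1 t = y] past = step_prob w (h n) y.
  exact: (XQ.2 n h y Qp).
rewrite -t0h// (sE _ Et0.1) /cond_prob setIC => /(canRL (divfK _)) e.
have fp : Q past \is a fin_num by exact: fin_num_measure.
rewrite -(fineK (fin_num_measure Q _ (measurableI _ _ mp mX))) e.
  by rewrite EFinM fineK.
by rewrite fine_eq0.
Qed.

Local Close Scope ereal_scope.

Let q A : R := fine (Q A).

(** [E] is split by the position at time [n]: [y - 1], [y + 1], or another site, from which a step
    to [y] has probability 0. *)
Lemma history_step_site n E y : history_event n E ->
  q (E `&` [set t | X n.+1 t = y]) =
  w (y - 1) * q (E `&` [set t | X n t = y - 1]) +
  (1 - w (y + 1)) * q (E `&` [set t | X n t = y + 1]).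
Proof.
move=> hE; pose A z := E `&` [set t | X n t = z].
have hA z : history_event n (A z) by apply: history_eventI => //; exact: history_event_site.
pose B := E `&` [set t | X n t != y - 1 /\ X n t != y + 1].
have hB : history_event n B.
  by apply: history_eventI => // t t' /(_ n (leqnn n)) /= ->.
have qA : forall F s, history_event n F ->
    (forall t, F t -> step_prob w (X n t) y = s) ->
    q (F `&` [set t | X n.+1 t = y]) = s * q F.
  move=> F s hF sF; rewrite /q (history_step hF sF) fineM//.
  by rewrite fin_num_measure//; exact: measurable_history hF.
rewrite -(qA (A (y - 1)) (w (y - 1))) //; last first.
  by move=> t [_ /= ->]; rewrite /step_prob subrK eqxx.
rewrite -(qA (A (y + 1)) (1 - w (y + 1))) //; last first.
  by move=> t [_ /= ->]; rewrite /step_prob addrK eqxx; case: eqVneq => //; lia.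
have qB0 : q (B `&` [set t | X n.+1 t = y]) = 0.
  rewrite (qA B 0) ?mul0r// => t [_ /= [/eqP y1 /eqP y2]]; rewrite /step_prob.
  by case: eqVneq => [?|_]; [lia|case: eqVneq => // ?; lia].
have mI F : history_event n F -> measurable (F `&` [set t | X n.+1 t = y]).
  by move=> /measurable_history mF; apply: measurableI => //; exact: measurable_site.
have qD F G : history_event n F -> history_event n G -> F `&` G = set0 ->
    q ((F `|` G) `&` [set t | X n.+1 t = y]) =
    q (F `&` [set t | X n.+1 t = y]) + q (G `&` [set t | X n.+1 t = y]).
  move=> hF hG FG; rewrite /q setIUl measureU ?fineD ?fin_num_measure//; try exact: mI.
  by rewrite setIACA FG set0I.
rewrite -[RHS]addr0 -qB0 -!qD //.
- congr (q (_ `&` _)); apply/seteqP; split=> [t Et|t [[] []|[]]//].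
  have [e1|/eqP e1] := eqVneq (X n t) (y - 1); first by left; left.
  have [e2|/eqP e2] := eqVneq (X n t) (y + 1); first by left; right.
  by right; split=> //; split; apply/eqP.
- by move=> t t' tt' [/(hA _ _ _ tt')|/(hA _ _ _ tt')]; [left|right].
- rewrite -subset0 => t [[] [_ /= e1] [_ []]]; by rewrite e1 eqxx.
- rewrite -subset0 => t [[_ /= e1] [_ /= e2]]; lia.
Qed.

(** The Markov property at time [n]; the induction lengthens the path at its end, hence [kernSr]. *)
Lemma walk_kern n k z y E : history_event n E -> E `<=` [set t | X n t = z] ->
  q (E `&` [set t | X (n + k)%N t = y]) =
  q E * kern w (fun x => 1 - w x) k z y.
Proof.
move=> hE Ez; elim: k y => [|k IHk] y.
  rewrite addn0 /=; have [zy|zy] := eqVneq z y.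
    by rewrite mulr1 setIidl// -zy.
  rewrite mulr0 (_ : _ `&` _ = set0) ?/q ?measure0//.
  by rewrite -subset0 => t [/Ez /= e1 /= e2]; rewrite -e1 -e2 eqxx in zy.
rewrite addnS history_step_site; last first.
  by move=> t t' tt'; apply: hE => i ik; apply: tt'; lia.
rewrite !IHk kernSr; ring.
Qed.

Lemma walk_start A : measurable A -> q ([set t | X 0%N t = 0] `&` A) = q A.
Proof.
move=> mA; have mX := measurable_site 0 0.
have : Q (~` [set t | X 0%N t = 0]) = 0%E.
  by rewrite probability_setC// XQ.1 subee.
rewrite setIC => Q0; rewrite /q -[in RHS](setIT A) -(setUv [set t | X 0%N t = 0]) setIUr.
rewrite measureU//; [|exact: measurableI|apply: measurableI => //; exact: measurableC|].
  rewrite [X in (_ + X)%E](_ : _ = 0%E) ?adde0//.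
  apply/eqP; rewrite eq_le measure_ge0 andbT -Q0 le_measure ?inE//.
    by apply: measurableI => //; exact: measurableC.
  exact: measurableC.
by rewrite setIACA setICr setI0.
Qed.

Lemma walk_return k y :
  q [set t | X k t = y] = kern w (fun x => 1 - w x) k 0 y.
Proof.
rewrite -walk_start; last exact: measurable_site.
have := @walk_kern 0 k 0 y _ (@history_event_site 0 0 0 (leqnn 0)) (@subset_refl _ _).
by rewrite add0n => ->; rewrite /q XQ.1 mul1r.
Qed.

Lemma walk_visit_return j k z y :
  q ([set t | X j t = z] `&` [set t | X (j + k)%N t = y]) =
  kern w (fun x => 1 - w x) j 0 z * kern w (fun x => 1 - w x) k z y.
Proof.
by rewrite (@walk_kern j k z)// ?walk_return//; exact: history_event_site.
Qed.

(** The weights vanish at the site being left, so [n] steps constrain the positions strictly before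
    time [n] only. *)
Definition killed (N : nat) (a : int -> R) (x : int) : R :=
  if (`|x| < N)%N then a x else 0.

Lemma walk_confined N n y :
  q ([set t | forall k, (k < n)%N -> (`|X k t| < N)%N] `&` [set t | X n t = y]) =
  kern (killed N w) (killed N (fun x => 1 - w x)) n 0 y.
Proof.
have hE m : history_event m [set t | forall k, (k < m)%N -> (`|X k t| < N)%N].
  by move=> t t' tt' Et k km; rewrite -tt' ?Et//; lia.
elim: n y => [|n IHn] y.
  rewrite (_ : mkset _ = setT) ?setTI ?walk_return//.
  by apply/seteqP; split.
have hE' : history_event n [set t | forall k, (k < n.+1)%N -> (`|X k t| < N)%N].
  by move=> t t' tt' Et k km; rewrite -tt' ?Et//; lia.
rewrite history_step_site// kernSr -!IHn.
have eqN z : q ([set t | forall k, (k < n.+1)%N -> (`|X k t| < N)%N] `&`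
                [set t | X n t = z]) =
    if (`|z| < N)%N
    then q ([set t | forall k, (k < n)%N -> (`|X k t| < N)%N] `&` [set t | X n t = z])
    else 0.
  case: ifPn => zN.
    congr q; apply/seteqP; split=> t [/= Et Xt]; split=> //= k kn.
      by apply: Et; lia.
    by have [->|kn'] := eqVneq k n; [rewrite Xt|apply: Et; lia].
  rewrite (_ : _ `&` _ = set0) ?/q ?measure0// -subset0 => t [/= /(_ n (leqnn _)) + Xt].
  by rewrite Xt (negbTE zN).
by rewrite !eqN /killed; do 2!case: ifP => _; rewrite ?mulr0 ?mul0r//; congr (_ + _); rewrite mulrC.
Qed.

End walk_history.

(** * Lower bound for the return probability from one fair stretch *)

Section return_lower_bound.
Variables (R : realType) (w : int -> R) (c : R).
Hypotheses (c0 : 0 < c) (wc : forall x, 2^-1 <= w x <= 1 - c).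

Let p n x := kern w (fun z => 1 - w z) n x 0.

Let w0 x : 0 <= w x. Proof. have /andP[] := wc x; lra. Qed.
Let w1 x : 0 <= 1 - w x. Proof. have := c0; have /andP[] := wc x; lra. Qed.
Let cw x : c <= w x. Proof. have /andP[] := wc x; lra. Qed.
Let cw1 x : c <= 1 - w x. Proof. have /andP[] := wc x; lra. Qed.
Let c1 : c <= 1. Proof. have /andP[] := wc 0; lra. Qed.
Let p0 n x : 0 <= p n x. Proof. exact: kern_ge0. Qed.
Let pS n x : p n.+1 x = w x * p n (x + 1) + (1 - w x) * p n (x - 1).
Proof. by []. Qed.

(* Adding two consecutive times removes the parity constraint. *)
Let s n x := p n x + p n.+1 x.

Let sS n x : s n.+1 x = w x * s n (x + 1) + (1 - w x) * s n (x - 1).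
Proof. by rewrite /s (pS n.+1) (pS n) ; ring. Qed.

Let s0 n x : 0 <= s n x. Proof. by rewrite addr_ge0. Qed.

Let s_stepl n x : c * s n (x - 1) <= s n.+1 x.
Proof.
rewrite sS -[leLHS]add0r lerD ?mulr_ge0//.
by rewrite ler_wpM2r.
Qed.

Let s_stepr n x : c * s n (x + 1) <= s n.+1 x.
Proof.
rewrite sS -[leLHS]addr0 lerD ?mulr_ge0//.
by rewrite ler_wpM2r.
Qed.

(** Each prescribed step costs at most a factor [c], and one of the two times in [s] has the parity
    of [x]. *)
Let s_reach n x : (`|x| <= n.+1)%N -> c ^+ n.+1 <= s n x.
Proof.
elim: n x => [|n IHn] x xn; last first.
  have [x0|x0] := leP x 0.
    apply: le_trans (s_stepr n x); rewrite exprS ler_wpM2l// ?IHn//; [exact: ltW|lia].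
  apply: le_trans (s_stepl n x); rewrite exprS ler_wpM2l// ?IHn//; [exact: ltW|lia].
rewrite expr1; have [->|x0] := eqVneq x 0.
  by rewrite (le_trans c1)// /s lerDl.
have p00 : p 0 0 = 1 by [].
have [->|->] : x = 1 \/ x = -1 by lia.
  rewrite /s pS subrr p00 mulr1 (le_trans (cw1 1))// addrA lerDr.
  by rewrite addr_ge0 ?mulr_ge0.
rewrite /s pS addNr p00 mulr1 (le_trans (cw (-1)))// addrCA lerDl.
by rewrite addr_ge0 ?mulr_ge0.
Qed.

(** The price of the [b] steps to the right that lead from 0 to the fair stretch. *)
Let s_descend b n : c ^+ b * s n b%:Z <= s (b + n) 0.
Proof.
suff : forall k, (k <= b)%N -> c ^+ k * s n b%:Z <= s (k + n) (b - k)%N.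
  by move=> /(_ b (leqnn b)); rewrite subnn.
elim=> [|k IHk] kb; first by rewrite mul1r subn0.
rewrite addSn; apply: le_trans (s_stepr _ _).
rewrite exprS -mulrA ler_wpM2l//; first exact: ltW.
by rewrite (_ : (b - k.+1)%N%:Z + 1 = (b - k)%N :> int) ?IHk//; lia.
Qed.

(* The subsolution is the cosine bump centred at the left end [b] of the fair
   stretch: to the left of [b] it increases, so a drift to the right only helps. *)
Lemma kern_fair_stretch (b l n : nat) :
  (forall x : int, b%:Z < x <= (b + l)%N%:Z -> w x = 2^-1) ->
  (b + b + l + 2 <= n.*2)%N ->
  c ^+ (b + b + l + 2) * cos (pi / (2 * l.+1%:R)) ^+ n.*2 <= p n.*2 0.
Proof.
move=> fair bn; set th := pi / _.
have pi0 := pi_gt0 R.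
have th0 : 0 < th by rewrite divr_gt0// mulr_gt0// ltr0n.
have thl : th * l.+1%:R = pi / 2.
  by rewrite /th invfM mulrA mulfVK// pnatr_eq0.
clearbody th; have thpi : th <= pi / 2 by rewrite -thl ler_peMr ?ler1n// ltW.
have cth : 0 <= cos th by rewrite cos_ge0_pihalf// thpi andbT (le_trans _ (ltW th0))// oppr_le0 divr_ge0// ltW.
have normE (z : int) : `|z%:~R * th| = `|z|%N%:R * th.
  by rewrite normrM (gtr0_norm th0) -intr_norm -abszE.
have bound (z : int) : (`|z| <= l.+1)%N -> - (pi / 2) <= z%:~R * th <= pi / 2.
  move=> zl; rewrite -ler_norml normE -thl mulrC ler_wpM2l ?(ltW th0)//.
  by rewrite ler_nat.
(* At distance [l.+1] from [b] the cosine vanishes by itself, since [th * l.+1%:R = pi / 2]; hence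
   the cosine formula holds one site beyond the cut-off. *)
pose v x : R := if (`|x - b%:Z| <= l)%N then cos ((x - b%:Z)%:~R * th) else 0.
have vE x : (`|x - b%:Z| <= l.+1)%N -> v x = cos ((x - b%:Z)%:~R * th).
  rewrite /v; case: ifPn => // xl xl1.
  rewrite -cos_norm normE (_ : `|x - b%:Z|%N = l.+1) ?(mulrC _ th) ?thl ?cos_pihalf//; lia.
have v0 x : 0 <= v x.
  by rewrite /v; case: ifP => // xl; rewrite cos_ge0_pihalf// bound//; lia.
have v1 x : v x <= 1 by rewrite /v; case: ifP => _; rewrite ?cos_le1.
have v_sub x : cos th * v x <= w x * v (x + 1) + (1 - w x) * v (x - 1).
  have [xl|xl] := leqP `|x - b%:Z| l; last first.
    by rewrite {1}/v leqNgt xl mulr0 addr_ge0// mulr_ge0.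
  rewrite !vE; [|lia..].
  rewrite (_ : x + 1 - b%:Z = x - b%:Z + 1); last by lia.
  rewrite (_ : x - 1 - b%:Z = x - b%:Z - 1); last by lia.
  have -> : (x - b%:Z + 1)%:~R * th = (x - b%:Z)%:~R * th + th.
    by rewrite -[X in _ = _ + X]mul1r -mulrDl (intrD _ (x - b%:Z) 1).
  have -> : (x - b%:Z - 1)%:~R * th = (x - b%:Z)%:~R * th - th.
    by rewrite -[X in _ = _ - X]mul1r -mulrBl (intrB _ (x - b%:Z) 1).
  set z := _%:~R * th; rewrite cosD cosB.
  (* The average over the neighbours exceeds [cos th * cos z] by [- (2 * w x - 1) * sin z * sin th]:
     zero at fair sites, nonnegative where [sin z <= 0]. *)
  have [xb|xb] := leP x b%:Z; last first.
    rewrite fair; last by lia.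
    by rewrite le_eqVlt; apply/orP; left; apply/eqP; field.
  have zs : sin z <= 0.
    rewrite -oppr_ge0 -sinN sin_ge0_pi// oppr_ge0; apply/andP; split.
      by rewrite /z mulr_le0_ge0 ?(ltW th0)// lerz0; lia.
    have /andP[] : - (pi / 2) <= z <= pi / 2 by apply: bound; lia.
    lra.
  have sth : 0 <= sin th by rewrite sin_ge0_pi// (ltW th0)/=; lra.
  have : 0 <= (2 * w x - 1) * (- sin z * sin th).
    by rewrite mulr_ge0 ?mulr_ge0 ?oppr_ge0//; have /andP[] := wc x; lra.
  lra.
(* By time [D], [s_reach] covers the whole support of the bump. *)
pose D := (b + l.+1)%N.
have sD m x : c ^+ D.+1 * cos th ^+ m * v x <= s (D + m) x.
  elim: m x => [|m IHm] x.
    rewrite mulr1 addn0; have [xl|xl] := leqP `|x - b%:Z| l; last first.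
      by rewrite /v leqNgt xl mulr0.
    apply: (@le_trans _ _ (c ^+ D.+1)); last by apply: s_reach; rewrite /D; lia.
    by rewrite ler_piMr// exprn_ge0// ltW.
  rewrite addnS sS (exprSr (cos th)) mulrA -(mulrA _ (cos th)).
  apply: (@le_trans _ _ (c ^+ D.+1 * cos th ^+ m * (w x * v (x + 1) + (1 - w x) * v (x - 1)))).
    by rewrite ler_wpM2l// mulr_ge0// exprn_ge0// ltW.
  rewrite mulrDr ![_ * cos th ^+ m * (_ * _)]mulrCA.
  by rewrite lerD// ler_wpM2l.
(* The two times in [s] become [n.*2 - 1] and [n.*2]; the odd one contributes nothing at 0. *)
have [m mE] : exists m, (b + (D + m)).+1 = n.*2.
  by exists (n.*2 - (b + D).+1)%N; rewrite /D; lia.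
have -> : p n.*2 0 = s (b + (D + m)) 0.
  rewrite /s mE; suff -> : p (b + (D + m)) 0 = 0 by rewrite add0r.
  by apply: kern_odd; rewrite subrr; lia.
apply: le_trans (s_descend _ _).
apply: le_trans (_ : c ^+ b * (c ^+ D.+1 * cos th ^+ m * v b%:Z) <= _); last first.
  by rewrite ler_wpM2l// exprn_ge0// ltW.
rewrite vE ?subrr// mul0r cos0 mulr1 mulrA -exprD.
rewrite (_ : (b + D.+1 = b + b + l + 2)%N); last by rewrite /D; lia.
rewrite ler_wpM2l ?exprn_ge0 ?(ltW c0)//.
(* As [cos th] lies in [[0, 1]], raising the exponent from [m] to [n.*2] only weakens the bound. *)
by apply: ler_wiXn2l; rewrite ?cos_le1//; lia.
Qed.

End return_lower_bound.

(** * Windows of consecutive sites *)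

Definition window (x : int) (l : nat) : seq int :=
  [seq x + m%:Z | m <- iota 0 l].

Lemma windowD x l m : window x (l + m) = window x l ++ window (x + l%:Z) m.
Proof.
rewrite /window iotaD map_cat add0n; congr (_ ++ _).
rewrite -[l in LHS]addn0 iotaDl -map_comp; apply: eq_map => i /=.
by rewrite PoszD addrA.
Qed.

Lemma size_window x l : size (window x l) = l.
Proof. by rewrite size_map size_iota. Qed.

Lemma window_uniq x l : uniq (window x l).
Proof. by rewrite map_inj_uniq ?iota_uniq// => i j; lia. Qed.

Lemma mem_window x l z : (z \in window x l) = (x <= z < x + l%:Z).
Proof.
apply/mapP/idP => [[i]|zx]; first by rewrite mem_iota => il ->; lia.
by exists `|z - x|%N; rewrite ?mem_iota; lia.
Qed.

(** * Upper bound for the return probability of a confined walk *)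

Section confined_upper_bound.
Variables (R : realType) (w : int -> R) (drift : pred int).
Variables (th Y k : R) (N K l : nat).
Hypotheses (w01 : forall x, 2^-1 <= w x <= 1).
Hypotheses (th0 : 0 < th) (Y0 : 0 <= Y) (Ypi : Y < pi / 2) (k01 : 0 <= k <= 1).
Hypothesis drift_tan : forall x, drift x ->
  forall y, 0 <= y <= Y -> (1 - w x) * tan y <= w x * tan (k * y).
Hypothesis l0 : (0 < l)%N.
Hypothesis thY : th * l%:R <= (1 - k ^+ K) * Y.
Hypothesis windows : forall x, - N%:Z <= x -> x + l%:Z <= N%:Z ->
  (K <= count drift (window x l))%N.

Let f i : R := if drift (i%:Z - N%:Z) then k else 1.

Let f01 i : 0 <= f i <= 1.
Proof. by rewrite /f; case: ifP; rewrite ?ler01 ?lexx. Qed.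

(* The phase [y] of the supersolution [u], at the site [i - N], advances by [th]
   at every site and is contracted by [k] at the drift sites. *)
Let y : nat -> R := fix y i := if i is j.+1 then f j * y j + th else th.

Let y_window i m :
  y (i + m) <= k ^+ count drift (window (i%:Z - N%:Z) m) * y i + th * m%:R.
Proof.
have k0 : 0 <= k by case/andP: k01.
elim: m => [|m IHm].
  by rewrite addn0 mul1r mulr0 addr0.
have /andP[f0 f1] := f01 (i + m).
rewrite addnS -[m.+1]addn1 natrD mulrDr mulr1 addrA windowD count_cat /= lerD2r.
apply: le_trans (ler_wpM2l f0 IHm) _.
rewrite mulrDr lerD//; last by rewrite ler_piMl// mulr_ge0// ltW.
rewrite mulrA /f (_ : i%:Z - N%:Z + m%:Z + 0 = (i + m)%N%:Z - N%:Z); last by lia.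
by case: ifP => _; rewrite ?addn1 ?addn0 ?exprS ?mul1r.
Qed.

Let y_gt0 i : 0 < y i.
Proof.
elim: i => [//|i IHi] /=; have /andP[f0 f1] := f01 i.
by rewrite ltr_wpDl// mulr_ge0// ltW.
Qed.

(** A phase at most [Y], contracted at least [K] times over the next [l] sites, ends at most at
    [k ^+ K * Y + th * l%:R <= Y]. The first [l] phases need no contraction: they are at most
    [th * l%:R]. *)
Let y_le i : (i <= N.*2)%N -> y i <= Y.
Proof.
have /andP[k0 k1] := k01.
have kK : k ^+ K <= 1 by rewrite exprn_ile1.
elim/ltn_ind: i => i IHi iN; have [il|li] := ltnP i l.
  have := y_window 0 i; rewrite add0n => /le_trans; apply.
  apply: (@le_trans _ _ (th + th * i%:R)).
    by rewrite lerD2r ler_piMl ?(ltW th0)// exprn_ile1.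
  rewrite -{1}[th]mulr1 -mulrDr nat1r.
  apply: (@le_trans _ _ (th * l%:R)); first by rewrite ler_wpM2l ?(ltW th0)// ler_nat.
  by apply: le_trans thY _; rewrite ler_piMl// gerBl exprn_ge0.
have := y_window (i - l) l; rewrite subnK// => /le_trans; apply.
apply: (@le_trans _ _ (k ^+ K * Y + (1 - k ^+ K) * Y)); last by rewrite -mulrDl subrKC mul1r.
apply: lerD => //; apply: ler_pM; rewrite ?exprn_ge0 ?(ltW (y_gt0 _))//.
  apply: ler_wiXn2l; rewrite ?k0//.
  by apply: windows; lia.
by apply: IHi; lia.
Qed.

Let cosy i : (i <= N.*2)%N -> 0 < cos (y i).
Proof.
move=> iN; apply: cos_gt0_pihalf; rewrite (le_lt_trans (y_le iN))// andbT.
by have := y_gt0 i; have := pi_gt0 R; have := Ypi; lra.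
Qed.

Let cosfy i : (i <= N.*2)%N -> 0 < cos (f i * y i).
Proof.
move=> iN; have /andP[f0 f1] := f01 i.
have fy : f i * y i <= y i by rewrite ler_piMl// ltW.
apply: cos_gt0_pihalf; rewrite (le_lt_trans (le_trans fy (y_le iN)))// andbT.
have : 0 <= f i * y i by rewrite mulr_ge0// ltW.
by have := pi_gt0 R; have := Ypi; lra.
Qed.

Let u : nat -> R := fix u i :=
  if i is j.+1 then u j * (cos (y i) / cos (f j * y j)) else 1.

Let u_gt0 i : (i <= N.*2)%N -> 0 < u i.
Proof.
elim: i => [//|i IHi] iN; rewrite -[u _]/(u i * (cos (y i.+1) / cos (f i * y i))).
by rewrite mulr_gt0 ?divr_gt0 ?IHi ?cosy ?cosfy//; lia.
Qed.

(** Up to the factors [sin th] and [u], this is the supersolution inequality. At a drift site it is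
    the hypothesis on [k]; elsewhere [f i = 1] and [1 - w <= w]. *)
Let tan_drift i : (i <= N.*2)%N ->
  (1 - w (i%:Z - N%:Z)) * tan (y i) <= w (i%:Z - N%:Z) * tan (f i * y i).
Proof.
move=> iN; rewrite /f; case: ifPn => [dr|_].
  by apply: drift_tan => //; rewrite ltW//= y_le.
rewrite mul1r ler_wpM2r//; last by have /andP[] := w01 (i%:Z - N%:Z); lra.
rewrite divr_ge0 ?(ltW (cosy iN))// sin_ge0_pi// (ltW (y_gt0 i))/=.
by have := y_le iN; have := pi_gt0 R; have := Ypi; lra.
Qed.

Lemma kern_confined n :
  kern (killed N w) (killed N (fun x => 1 - w x)) n 0 0 <= cos th ^+ n.
Proof.
(* Killed sites have no outgoing weight, so the inequality is at stake only for [|x| < N], where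
   both neighbours still lie in [[-N, N]]. *)
pose U x := if (`|x| <= N)%N then u `|(x + N%:Z)%R|%N else 0.
have U0 x : 0 <= U x by rewrite /U; case: ifP => // xN; rewrite ltW// u_gt0//; lia.
have UN : 0 < U 0 by rewrite /U /= u_gt0//; lia.
have th1 : 0 <= cos th.
  by rewrite ltW// -[th]/(y 0) cosy.
rewrite -(ler_pM2r UN); apply: kern_supersolution => //.
- by move=> x; rewrite /killed; case: ifP => // _; have /andP[] := w01 x; lra.
- by move=> x; rewrite /killed; case: ifP => // _; have /andP[] := w01 x; lra.
move=> x; rewrite /killed; case: ifPn => [xN|_]; last by rewrite !mul0r addr0 mulr_ge0.
rewrite /U !ifT; [|lia..].
have [i iE] : exists i, `|(x + N%:Z)%R|%N = i.+1 by exists `|(x + N%:Z)%R|%N.-1; lia.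
rewrite iE (_ : `|(x + 1 + N%:Z)%R|%N = i.+2) 1?(_ : `|(x - 1 + N%:Z)%R|%N = i); [|lia..].
have xE : x = i.+1%:Z - N%:Z by lia.
have := tan_drift (_ : (i.+1 <= N.*2)%N); rewrite -xE => /(_ ltac:(lia)) td.
have uS j : u j.+1 = u j * (cos (y j.+1) / cos (f j * y j)) by [].
have ui : 0 < u i by apply: u_gt0; lia.
have ci : 0 < cos (f i * y i) by apply: cosfy; lia.
have ci1 : 0 < cos (y i.+1) by apply: cosy; lia.
have cfi1 : 0 < cos (f i.+1 * y i.+1) by apply: cosfy; lia.
(* Seen from index [i.+1], the left ratio is a cosine at phase [y i.+1 - th] over one at [y i.+1],
   the right ratio one at [f i.+1 * y i.+1 + th] over one at [f i.+1 * y i.+1]. *)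
have uE : u i = u i.+1 * (cos th + sin th * tan (y i.+1)).
  have e : cos (f i * y i) = cos (y i.+1) * (cos th + sin th * tan (y i.+1)).
    rewrite (_ : f i * y i = y i.+1 - th); last by rewrite /= addrK.
    by rewrite cosB /tan; field; rewrite gt_eqF.
  by rewrite uS -mulrA mulrAC -e divff ?mulr1// gt_eqF.
have uE' : u i.+2 = u i.+1 * (cos th - sin th * tan (f i.+1 * y i.+1)).
  rewrite uS; congr (_ * _).
  rewrite (_ : y i.+2 = f i.+1 * y i.+1 + th)// cosD /tan.
  by field; rewrite gt_eqF.
rewrite uE uE'; have u1 : 0 < u i.+1 by apply: u_gt0; lia.
rewrite [w x * _]mulrCA [(1 - w x) * _]mulrCA -mulrDr [cos th * _]mulrC ler_pM2l//.
have sth : 0 <= sin th.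
  rewrite sin_ge0_pi// (ltW th0)/=; have : y 0 <= Y by exact: y_le.
  by have := pi_gt0 R; have := Ypi; rewrite /=; lra.
have := ler_wpM2l sth td; lra.
Qed.

End confined_upper_bound.

(** * Cost of a far excursion, by reversibility *)

Section visit_bound.
Variables (R : realType) (w : int -> R) (c : R).
Hypotheses (c0 : 0 < c) (wc : forall x, 2^-1 <= w x <= 1 - c).

Let w0 x : 0 < w x. Proof. have /andP[] := wc x; lra. Qed.
Let w1 x : 0 < 1 - w x. Proof. have := c0; have /andP[] := wc x; lra. Qed.
Let r x : R := (1 - w x) / w x.
Let r0 x : 0 < r x. Proof. by rewrite divr_gt0. Qed.

(** The edges between 0 and [z], each labelled by its left end. *)
Definition path_to (z : int) : seq int :=
  if 0 <= z then window 0 `|z| else window z `|z|.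

Let rho z : R := \prod_(x <- path_to z) r x.

Let prod_gt0 s : 0 < \prod_(x <- s) r x.
Proof. by elim/big_ind: _ => // *; exact: mulr_gt0. Qed.

Let rho_gt0 z : 0 < rho z. Proof. exact: prod_gt0. Qed.

(** A reversible measure of the walk: products of [w / (1 - w)] from 0 to [z], inverted to the left
    of 0, over [1 - w z]. *)
Let m z : R := (if 0 <= z then (rho z)^-1 else rho z) / (1 - w z).

Let m_balance z : m z * w z = m (z + 1) * (1 - w (z + 1)).
Proof.
rewrite /m divfK ?gt_eqF// /rho /path_to; have [z0|z0] := leP 0 z.
  rewrite !ifT; [|lia..].
  rewrite (_ : `|(z + 1)%R|%N = (`|z| + 1)%N); last by lia.
  rewrite windowD big_cat /= big_seq1 addr0 add0r (_ : `|z|%:Z = z); last by lia.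
  have := prod_gt0 (window 0 `|z|); set Pz := \prod_(_ <- _) _ => Pz0.
  by rewrite /r invfM invf_div; field; rewrite !gt_eqF.
rewrite (_ : `|z|%N = (1 + `|(z + 1)%R|)%N); last by lia.
rewrite windowD big_cat /= big_seq1 addr0 /r.
have [z1|z1] := leP 0 (z + 1).
  rewrite (_ : z + 1 = 0); last by lia.
  by rewrite big_nil; field; rewrite gt_eqF//= gt_eqF.
by field; rewrite gt_eqF//= gt_eqF.
Qed.

Let m_gt0 z : 0 < m z.
Proof. by rewrite /m divr_gt0//; case: ifP => _ //; rewrite invr_gt0. Qed.

Let p := kern w (fun x => 1 - w x).

Let p01 n x y : 0 <= p n x y <= 1.
Proof.
rewrite kern_ge0 ?kern_le1//= => x'; rewrite ?subrKC//; exact: ltW.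
Qed.

(** For [z >= 0] the way back is costly, for [z < 0] the way out: reversibility bounds that factor
    by a ratio of values of [m], and the other is at most 1. The quotient of the terms [1 - w] is
    absorbed by [c^-1]. *)
Lemma kern_visit_return j k z :
  p j 0 z * p k z 0 <= c^-1 * \prod_(x <- path_to z) ((1 - w x) / w x).
Proof.
have /andP[pj0 pj1] := p01 j 0 z; have /andP[pk0 pk1] := p01 k z 0.
have m00 : m 0 = (1 - w 0)^-1 by rewrite /m /= /rho /path_to big_nil invr1 div1r.
have cw x : (1 - w x) <= 1 by have := w0 x; lra.
have wcx x : (1 - w x)^-1 <= c^-1.
  by rewrite lef_pV2 ?posrE//; have /andP[] := wc x; lra.
rewrite -/r -/(rho z).
have cc x y : (1 - w x) / (1 - w y) <= c^-1.
  by rewrite -[leRHS]mul1r ler_pM// ?invr_ge0 ltW.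
have rev i x y : m x * p i x y = m y * p i y x by apply: kern_reversible.
have [z0|z0] := leP 0 z.
  apply: (@le_trans _ _ (p k z 0)); first by rewrite ler_piMl.
  have /andP[_ pz1] := p01 k 0 z.
  have : m z * p k z 0 <= m 0 by rewrite rev ler_piMr ?(ltW (m_gt0 _)).
  rewrite mulrC -ler_pdivlMr// => /le_trans; apply.
  have -> : m 0 / m z = (1 - w z) / (1 - w 0) * rho z.
    by rewrite m00 /m z0; field; rewrite !gt_eqF.
  by rewrite ler_wpM2r// ltW.
apply: (@le_trans _ _ (p j 0 z)); first by rewrite ler_piMr.
have /andP[_ pz1] := p01 j z 0.
have : m 0 * p j 0 z <= m z by rewrite rev ler_piMr ?(ltW (m_gt0 _)).
rewrite mulrC -ler_pdivlMr// => /le_trans; apply.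
have -> : m z / m 0 = (1 - w 0) / (1 - w z) * rho z.
  by rewrite m00 /m leNgt z0 /=; field; rewrite !gt_eqF.
by rewrite ler_wpM2r// ltW.
Qed.

End visit_bound.

(** In [n] unit steps from [x] no site at distance [N] or more from 0 is left, so killing has no
    effect. *)
Lemma kern_killed_speed (R : realType) (a b : int -> R) N n x y :
  (`|x| + n <= N)%N -> kern (killed N a) (killed N b) n x y = kern a b n x y.
Proof.
elim: n x => [//|n IHn] x xN; rewrite !kernS !IHn; [|lia..].
by rewrite /killed !ifT //; lia.
Qed.

(** * Union bounds and confinement for the conditioned walk *)

Section union_bound.
Context d (T : measurableType d) (R : realType) (P : probability T R).

Lemma union_bound (I : eqType) (s : seq I) (F : I -> set T) (A : set T) (r : R) :
  measurable A -> (forall i, measurable (F i)) ->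
  (forall t, A t -> exists2 i, i \in s & F i t) ->
  (forall i, i \in s -> fine (P (F i)) <= r) ->
  fine (P A) <= (size s)%:R * r.
Proof.
elim: s A => [|i s IHs] A mA mF AF Pr.
  rewrite (_ : A = set0) ?measure0 ?mul0r// -subset0 => t /AF[i]; rewrite in_nil//.
have mAs : measurable (A `\` F i) by exact: measurableD.
have PA B : measurable B -> P B \is a fin_num by move=> mB; exact: fin_num_measure.
rewrite (measureDI P mA (mF i)) fineD ?PA//; last exact: measurableI.
rewrite [size _]/= -nat1r mulrDl mul1r addrC lerD//.
  rewrite (le_trans _ (Pr i _)) ?mem_head// fine_le ?PA//; first exact: measurableI.
  exact: measureIr.
apply: IHs => //; last by move=> j js; rewrite Pr// in_cons js orbT.
move=> t [/AF[j]]; rewrite in_cons => /predU1P[->//|js] Fj _.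
by exists j.
Qed.

End union_bound.

Section conditioned_walk.
Variables (R : realType) (w : environment R).
Variables (d : measure_display) (T : measurableType d) (Q : probability T R).
Variable X : nat -> {mfun T >-> int}.
Hypothesis XQ : quenched_walk w Q X.
Variables (n : nat) (r : R).

Let p N := kern (killed N w) (killed N (fun x => 1 - w x)) n 0 0.
Let p0 := kern w (fun x => 1 - w x) n 0 0.
Let B := [set t | X n t = 0].
Let A := [set t | (max_abs X n t)%:R >= r :> R].
Let conf N := [set t | forall k, (k < n)%N -> (`|X k t| < N)%N].

Let hA : history_event X n A.
Proof.
move=> t t' tt'; rewrite /A /= /max_abs => /le_trans; apply.
rewrite ler_nat; apply/eq_leq/eq_bigr => k _; rewrite tt'//.
by have := ltn_ord k; lia.
Qed.

Let hconf N : history_event X n (conf N).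
Proof. by move=> t t' tt' Et k kn; rewrite -tt' ?Et//; lia. Qed.

Let mA : measurable A. Proof. exact: measurable_history hA. Qed.
Let mB : measurable B. Proof. exact: measurable_site. Qed.
Let mconf N : measurable (conf N). Proof. exact: measurable_history (@hconf N). Qed.

Let qD C D : measurable C -> measurable D ->
  fine (Q C) = fine (Q (C `\` D)) + fine (Q (C `&` D)).
Proof.
move=> mC mD; rewrite (measureDI Q mC mD) fineD// fin_num_measure//.
  exact: measurableD.
exact: measurableI.
Qed.

Let q_le C D : measurable C -> measurable D -> C `<=` D ->
  fine (Q C) <= fine (Q D).
Proof.
by move=> mC mD CD; rewrite fine_le ?fin_num_measure// le_measure ?inE.
Qed.

Let qB : fine (Q B) = p0. Proof. exact: walk_return. Qed.

Let q_ge0 C : 0 <= fine (Q C). Proof. exact: fine_ge0. Qed.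

Let attained t : exists2 k, (k <= n)%N & max_abs X n t = `|X k t|%N.
Proof.
have [|k kE] := @bigop.eq_bigmax 'I_n.+1 (fun k => `|X k t|%N); first by rewrite card_ord.
by exists k; [have := ltn_ord k; lia|exact: kE].
Qed.

Lemma cond_prob_ge0 : 0 <= cond_prob Q A B.
Proof. by rewrite divr_ge0. Qed.

(** A union bound over the time and the site of a visit: [n.+1] times and [n.*2.+1] sites, each pair
    estimated by reversibility. *)
Lemma cond_prob_le_visits (c e : R) : 0 < c ->
  (forall x, 2^-1 <= w x <= 1 - c) -> 0 <= e ->
  (forall z : int, r <= `|z|%N%:R -> (`|z| <= n)%N ->
     \prod_(x <- path_to z) ((1 - w x) / w x) <= e) ->
  cond_prob Q A B <= (n.+1 * n.*2.+1)%:R * (c^-1 * e) / p0.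
Proof.
move=> c0 wc e0 he; rewrite /cond_prob qB ler_wpM2r ?invr_ge0 -?qB//.
(* Steps have size one only almost surely; trajectories leaving [[-n, n]] are first discarded as a
   null event. *)
have lost : fine (Q (B `\` conf n.+1)) = 0.
  have := qD mB (mconf n.+1); rewrite qB setIC (walk_confined XQ).
  rewrite kern_killed_speed; last by lia.
  by move/eqP; rewrite -subr_eq subrr => /eqP.
have mAB : measurable (A `&` B) by exact: measurableI.
rewrite (qD mAB (mconf n.+1)) (_ : fine (Q _) = 0) ?add0r; last first.
  apply/eqP; rewrite eq_le q_ge0 andbT -lost q_le//; try exact: measurableD.
  by move=> t [[_ ?] ?].
pose F (jz : nat * int) := if r <= `|jz.2|%N%:R
  then [set t | X jz.1 t = jz.2] `&` B else set0.
have mF jz : measurable (F jz).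
  by rewrite /F; case: ifP => // _; apply: measurableI => //; exact: measurable_site.
pose s := [seq (j, z) | j <- iota 0 n.+1, z <- window (- n%:Z) n.*2.+1].
have <- : size s = (n.+1 * n.*2.+1)%N.
  by rewrite size_allpairs size_iota size_window.
apply: (union_bound _ mF) => [|t [[At Bt] ct]|jz /allpairsP[[j z] [+ zn ->]]].
- exact: measurableI.
- have [k kn kE] := attained t; exists (k, X k t).
    apply/allpairsP; exists (k, X k t); split=> //.
      by rewrite mem_iota [_.1]/=; lia.
    rewrite [_.2]/= mem_window; have [->|kn'] := eqVneq k n; first by rewrite Bt; lia.
    by have := ct k ltac:(lia); lia.
  by rewrite /F /= -kE ifT.
rewrite mem_iota /= => jn; rewrite /F /=; case: ifPn => [rz|_]; last first.
  by rewrite measure0 mulr_ge0// invr_ge0 ltW.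
rewrite /B (_ : n = j + (n - j))%N; last by lia.
rewrite (walk_visit_return XQ); apply: le_trans (kern_visit_return c0 wc _ _ _) _.
rewrite ler_wpM2l ?invr_ge0 ?(ltW c0)// he//.
by move: zn; rewrite /= mem_window; lia.
Qed.

(** A walk whose maximum stays below [r] is confined below [N], so returns without a large
    displacement have probability at most [p N]. *)
Lemma cond_prob_ge_confined N : 0 < p0 ->
  (forall m : nat, m%:R < r -> (m < N)%N) ->
  1 - p N / p0 <= cond_prob Q A B <= 1.
Proof.
move=> p00 rN; rewrite /cond_prob qB; have := qD mB mA.
rewrite qB setIC => qAB.
rewrite ler_pdivlMr// mulrBl mul1r divfK ?gt_eqF// ler_pdivrMr// mul1r.
have := q_ge0 (B `\` A); suff : fine (Q (B `\` A)) <= p N by lra.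
have -> : p N = fine (Q (conf N `&` B)) by rewrite (walk_confined XQ).
apply: q_le; [exact: measurableD|exact: measurableI|].
move=> t [Bt /negP]; rewrite -ltNge => At; split=> // k kn.
apply: rN; apply: le_lt_trans At; rewrite ler_nat.
rewrite /max_abs; have kn1 : (k < n.+1)%N by lia.
exact: (@bigop.leq_bigmax _ (fun i : 'I_n.+1 => `|X i t|%N) (Ordinal kn1)).
Qed.

End conditioned_walk.

(** * Asymptotics in [ln n] and the resulting lower bound *)

Section asymptotics.
Variable R : realType.

Let pinfty_ge (r : R) : \forall x \near +oo, r <= x.
Proof. by apply: nbhs_pinfty_ge; rewrite num_real. Qed.

(** The term of degree 4 in the exponential series suffices. The cube arises from comparing [ln n]
    with [n / ln n ^+ 2]. *)
Lemma expR_dominates (e k : R) : 0 < e ->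
  \forall L \near +oo, k * L ^+ 3 <= expR (e * L).
Proof.
move=> e0; near=> L.
have L0 : 0 <= L by near: L; exact: pinfty_ge.
apply: le_trans (expR_ge1Dxn 3 (mulr_ge0 (ltW e0) L0)).
have kL : k * 24 / e ^+ 4 <= L by near: L; exact: pinfty_ge.
rewrite (_ : (4`!)%:R = 24 :> R)// exprMn (exprSr L 3).
apply: (@le_trans _ _ (e ^+ 4 * L / 24 * L ^+ 3)).
  rewrite ler_wpM2r ?exprn_ge0// ler_pdivlMr//.
  by rewrite [leRHS]mulrC -ler_pdivrMr ?exprn_gt0.
by rewrite (_ : _ * L ^+ 3 = e ^+ 4 * (L ^+ 3 * L) / 24) ?lerDr//; field.
Unshelve. all: by end_near. Qed.

Lemma near_ln (p : R -> Prop) : (\forall L \near +oo, p L) ->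
  \forall n \near \oo, p (ln (n%:R : R)).
Proof.
move=> [M [_ pM]]; near=> n; apply: pM.
have n0 : (0 : R) < n%:R by near: n; exists 1%N => // k /= k0; rewrite ltr0n.
rewrite -ltr_expR lnK ?posrE//; near: n.
exact: nbhs_infty_gtr.
Unshelve. all: by end_near. Qed.

Lemma near_ln_ge (r : R) : \forall n \near \oo, r <= ln n%:R.
Proof. exact: near_ln (pinfty_ge r). Qed.

Lemma near_ln_dominated (e k : R) : 0 < e ->
  \forall n \near \oo, k * ln n%:R ^+ 3 <= expR (e * ln n%:R).
Proof. by move=> e0; exact: near_ln (expR_dominates k e0). Qed.

Lemma near_expR_ln : \forall n \near \oo, expR (ln (n%:R : R)) = n%:R.
Proof. by exists 1%N => // n /= n0; rewrite lnK// posrE ltr0n. Qed.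

(** [A] will be slightly above [1 / alpha]: about [A ^+ l] disjoint blocks of length [l] are
    searched, whence the factor [l]. *)
Definition fair_stretches (w : int -> R) (A : R) : Prop :=
  \forall l \near \oo, exists2 b : nat, b%:R <= l%:R * (A ^+ l + 1) &
    forall x : int, b%:Z < x <= (b + l)%N%:Z -> w x = 2^-1.

(** The ratio [ln B / h] compares the logarithm of the range with the window length; it has to come
    close to [- ln alpha]. *)
Definition many_drifts (w : int -> R) (s : R) (h : nat) (B : R) : Prop :=
  \forall j \near \oo, forall x : int, `|x|%N%:R <= B ^+ j ->
    (j < count (fun z => s <= w z)%R (window x (h * j)))%N.

Lemma exprn_expR (x : R) n : 0 < x -> x ^+ n = expR (n%:R * ln x).
Proof. by move=> x0; rewrite expRM_natl lnK ?posrE. Qed.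

(** A fair stretch of length about [tau * ln n] starts within [n] to the power [tau * ln A < 1], up
    to a logarithm, so reaching it costs little on the scale [n / ln n ^+ 2]. *)
Lemma kern_return_lower_bound (w : int -> R) (c A tau e : R) :
  0 < c -> (forall x, 2^-1 <= w x <= 1 - c) ->
  1 < A -> fair_stretches w A -> 0 < tau -> tau * ln A < 1 -> 0 < e ->
  \forall n \near \oo,
    expR (- (e * (n%:R / ln n%:R ^+ 2))) *
      cos (pi / 2 / tau / ln n%:R) ^+ (2 * n) <=
    kern w (fun x => 1 - w x) (2 * n) 0 0.
Proof.
move=> c0 wc A1 [l0 _ fair] tau0 tauA e0.
have c1 : c <= 1 by have /andP[] := wc 0; lra.
have lc : 0 <= - ln c by rewrite oppr_ge0 ln_le0.
have A0 : 0 < A by rewrite (lt_trans _ A1).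
have lA : 0 < ln A by rewrite ln_gt0.
near=> n; set L := ln n%:R.
have nE : expR L = n%:R by rewrite /L; near: n; exact: near_expR_ln.
have L1 : 1 <= L by rewrite /L; near: n; exact: near_ln_ge.
(* [dom1] makes the journey fit into time [2 * n]; [dom2] keeps its cost below [e * (n / L ^+ 2)] in
   the exponent. *)
have dom1 : (5 * tau + 2) * L ^+ 3 <= expR ((1 - tau * ln A) * L).
  by rewrite /L; near: n; apply: near_ln_dominated; lra.
have dom2 : (5 * tau + 2) * (- ln c / e) * L ^+ 3 <= expR ((1 - tau * ln A) * L).
  by rewrite /L; near: n; apply: near_ln_dominated; lra.
have tL1 : 1 <= tau * L.
  rewrite mulrC -ler_pdivrMr// /L; near: n; exact: near_ln_ge.
have tLl0 : l0%:R <= tau * L.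
  rewrite mulrC -ler_pdivrMr// /L; near: n; exact: near_ln_ge.
have tL0 : 0 <= tau * L by exact: le_trans tL1.
clearbody L.
pose l := Num.truncn (tau * L).
have /andP[l_le l_gt] := truncn_itv tL0; rewrite -/l in l_le l_gt.
have [|b bl bfair] := fair l; first by rewrite /= truncn_ge_nat.
clearbody l.
set E := expR (tau * ln A * L).
have L0 : 0 <= L by exact: le_trans L1.
have E1 : 1 <= E by rewrite -expR0 ler_expR !mulr_ge0// ltW.
have AlE : A ^+ l <= E.
  rewrite (exprn_expR _ A0).
  by rewrite ler_expR mulrAC ler_wpM2r// ltW.
have EE : expR ((1 - tau * ln A) * L) * E = n%:R.
  by rewrite -expRD -nE; congr expR; ring.
(* Here [b <= 2 * tau * L * E], so [2 b + l + 2] is at most [(4 tau + tau + 2) * L * E]. *)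
clearbody E; have cost : (b + b + l + 2)%N%:R <= (5 * tau + 2) * L * E.
  have blE : b%:R <= 2 * (tau * L * E).
    apply: le_trans bl _; apply: (@le_trans _ _ ((tau * L) * (E + E))); last by lra.
    by apply: ler_pM => //; [rewrite addr_ge0// exprn_ge0//; lra|lra].
  have tLE : tau * L <= tau * L * E by rewrite ler_peMr.
  have LE : 1 <= L * E by rewrite mulr_ege1.
  by rewrite !natrD; lra.
have L30 k : k * L ^+ 3 * E = k * L * E * L ^+ 2 by ring.
have L2 : 1 <= L ^+ 2 by rewrite expr_ge1.
have cost1 : (b + b + l + 2)%N%:R <= n%:R :> R.
  have := ler_wpM2r (le_trans ler01 E1) dom1; rewrite EE L30.
  apply: le_trans; apply: le_trans cost _; rewrite ler_peMr//.
  by rewrite !mulr_ge0//; lra.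
have cost2 : (b + b + l + 2)%N%:R * - ln c <= e * (n%:R / L ^+ 2).
  have := ler_wpM2r (le_trans ler01 E1) dom2; rewrite EE.
  have L20 : 0 < L ^+ 2 by lra.
  move=> dom2'; rewrite [leRHS]mulrA ler_pdivlMr//.
  apply: le_trans (ler_wpM2l (ltW e0) dom2').
  rewrite (_ : e * _ = (5 * tau + 2) * L * E * - ln c * L ^+ 2); last by field; rewrite gt_eqF.
  by rewrite ler_wpM2r ?(ltW L20)// ler_wpM2r.
have bn : (b + b + l + 2 <= n.*2)%N.
  by rewrite -addnn (leq_trans _ (leq_addr n n))// -(ler_nat R).
rewrite mul2n; apply: le_trans (kern_fair_stretch c0 wc bfair bn).
have pi0 := pi_gt0 R.
have th1 : pi / 2 / tau / L <= pi / 2.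
  rewrite -mulrA -invfM ler_piMr//; first by lra.
  by rewrite invf_le1//; lra.
have th0 : 0 <= pi / 2 / tau / L by rewrite !divr_ge0//; lra.
have cos0' : 0 <= cos (pi / 2 / tau / L).
  by apply: cos_ge0_pihalf; rewrite th1 andbT; lra.
have thle : pi / (2 * l.+1%:R) <= pi / 2 / tau / L.
  rewrite invfM mulrA -[leRHS]mulrA -invfM ler_wpM2l//; first by lra.
  by rewrite lef_pV2 ?posrE// ?ltW//; lra.
apply: ler_pM; rewrite ?expR_ge0 ?exprn_ge0//.
  by rewrite (exprn_expR _ c0) ler_expR lerNl -mulrN.
apply: lerXn2r; rewrite ?nnegrE//.
- by rewrite (le_trans cos0')// cos_homo//; [rewrite divr_ge0 ?mulr_ge0//; lra|lra].
- by rewrite cos_homo//; [rewrite divr_ge0 ?mulr_ge0//; lra|lra].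
Unshelve. all: by end_near. Qed.

End asymptotics.

(** * Consequences of frequent drift sites *)

Lemma exprn_vanish (R : realType) (k e : R) : 0 <= k < 1 -> 0 < e ->
  exists n, k ^+ n < e.
Proof.
move=> /andP[k0 k1] e0; have nk : `|k| < 1 by rewrite ger0_norm.
have := @cvg_expr R _ nk => /cvgr0Pnorm_lt /(_ _ e0)[n _ /(_ n (leqnn n))] /=.
by rewrite ger0_norm ?exprn_ge0//; exists n.
Qed.

Lemma absz_window (N l : nat) (x : int) :
  - N%:Z <= x -> x + l%:Z <= N%:Z -> (`|x| <= N)%N.
Proof. by lia. Qed.

Lemma count_blocks (dr : pred int) l j k x :
  (forall y, x <= y -> y <= x + (k * l)%N%:Z -> (j <= count dr (window y l))%N) ->
  (k * j <= count dr (window x (k * l)))%N.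
Proof.
elim: k x => [//|k IHk] x xP; rewrite !mulSn windowD count_cat leq_add//.
  by apply: xP; lia.
by apply: IHk => y xy yx; apply: xP; lia.
Qed.

Lemma count_path_to (dr : pred int) l j z :
  (forall y, (`|y| <= `|z|)%N -> (j <= count dr (window y l))%N) ->
  (`|z| %/ l * j <= count dr (path_to z))%N.
Proof.
move=> zP; have lz := leq_trunc_div `|z| l.
have blocks x : (forall y, x <= y -> y <= x + `|z|%N%:Z -> (`|y| <= `|z|)%N) ->
    (`|z| %/ l * j <= count dr (window x `|z|))%N.
  move=> xP; rewrite {2}(divn_eq `|z|%N l) windowD count_cat.
  apply: leq_trans (leq_addr _ _); apply: count_blocks => y xy yx.
  by apply: zP; apply: xP => //; lia.
by rewrite /path_to; case: ifP => z0; apply: blocks => y; lia.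
Qed.

(** The extra [j] pays for the incomplete last block. *)
Lemma leq_blocks m h j : (0 < h * j)%N -> (m <= (m %/ (h * j) * j + j) * h)%N.
Proof. by move=> hj; have := ltn_ceil m hj; rewrite mulSn; lia. Qed.

Section drift_asymptotics.
Variables (R : realType) (w : int -> R) (s : R) (h : nat) (B : R).
Hypotheses (w01 : forall x, 2^-1 <= w x <= 1) (s01 : 2^-1 < s < 1).
Hypotheses (h0 : (0 < h)%N) (B1 : 1 < B) (drifts : many_drifts w s h B).

Let rho := (1 - s) / s.
Let s0 : 0 < s. Proof. have /andP[] := s01; lra. Qed.
Let rho01 : 0 < rho < 1.
Proof.
have /andP[s1 s2] := s01; have ss := s0.
by rewrite /rho divr_gt0 ?subr_gt0//= ltr_pdivrMr//; lra.
Qed.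
Let lB : 0 < ln B. Proof. exact: ln_gt0. Qed.

Let drift_rho x : s <= w x -> 1 - w x <= rho * w x.
Proof.
move=> sw; rewrite /rho mulrAC ler_pdivlMr ?s0// -subr_ge0.
by rewrite (_ : _ - _ = w x - s) ?subr_ge0//; ring.
Qed.

(* The least scale at which [many_drifts] covers sites up to [2 exp y]. *)
Let scale (y : R) : nat := (Num.truncn ((y + ln 2) / ln B)).+1.

Let scale_le y : 0 <= y -> (scale y)%:R <= (y + ln 2) / ln B + 1.
Proof.
move=> y0; rewrite /scale -natr1 lerD2r truncn_le.
by rewrite divr_ge0 ?addr_ge0 ?ln_ge0 ?ler1n// ltW.
Qed.

Let scale_ge y : 0 <= y -> (y + ln 2) / ln B <= (scale y)%:R.
Proof.
move=> y0; have /truncn_itv/andP[_ /ltW//] : 0 <= (y + ln 2) / ln B.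
by rewrite divr_ge0 ?addr_ge0 ?ln_ge0 ?ler1n// ltW.
Qed.

Let scale_cover y : 0 <= y -> 2 * expR y <= B ^+ scale y.
Proof.
move=> y0; rewrite exprn_expR; last by rewrite (lt_trans _ B1).
have -> : 2 * expR y = expR (y + ln 2) by rewrite expRD lnK ?posrE// mulrC.
by rewrite ler_expR -ler_pdivrMr// scale_ge.
Qed.

Let near_scale (g : R) (J : nat) : 0 < g ->
  \forall n \near \oo, (J <= scale (g * ln n%:R))%N.
Proof.
move=> g0; near=> n.
have L0 : 0 <= g * ln n%:R.
  by rewrite mulr_ge0 ?(ltW g0)//; near: n; exact: near_ln_ge.
rewrite -(ler_nat R); apply: le_trans (scale_ge L0).
rewrite ler_pdivlMr//; apply: (@le_trans _ _ (g * ln n%:R)); last first.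
  by rewrite lerDl ln_ge0// ler1n.
by rewrite -ler_pdivrMl//; near: n; exact: near_ln_ge.
Unshelve. all: by end_near. Qed.

Lemma kern_confined_upper_bound (g sigma : R) :
  0 < g -> 0 < sigma -> sigma * g * h%:R < pi / 2 * ln B ->
  \forall n \near \oo,
    let N := (Num.truncn (expR (g * ln n%:R))).+1 in
    kern (killed N w) (killed N (fun x => 1 - w x)) (2 * n) 0 0 <=
    cos (sigma / ln n%:R) ^+ (2 * n).
Proof.
move=> g0 sigma0; rewrite -ltr_pdivrMr//; set q := _ / ln B => qpi.
have qE : q = sigma * g * h%:R / ln B by [].
have hR : (0 : R) < h%:R by rewrite ltr0n.
have q0 : 0 < q by rewrite divr_gt0// !mulr_gt0.
clearbody q.
(* [q] is the limiting phase gained over one window. The gap from [q] to [q1] absorbs the rounding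
   of the scale, the gap from [q1] to [Y] the imperfect contraction. *)
pose Y := (q + pi / 2) / 2; pose q1 := (q + Y) / 2.
have Y0 : 0 < Y by rewrite /Y; lra.
have Ypi : Y < pi / 2 by rewrite /Y; lra.
have q1Y : q1 < Y by rewrite /q1 /Y; lra.
have qq1 : q < q1 by rewrite /q1 /Y; lra.
clearbody q1; clearbody Y.
have /andP[rho0 rho1] := rho01.
have [||k /andP[k0 k1] ktan] := @tan_contraction R rho Y.
- by rewrite rho1 ltW.
- by rewrite Ypi ltW.
(* [K] contractions bring [(1 - k ^+ K) * Y] above [q1]. *)
have [||K kK] := @exprn_vanish R k (1 - q1 / Y).
- by rewrite k0.
- by rewrite subr_gt0 ltr_pdivrMr// mul1r.
have [J0 _ drifts0] := drifts.
near=> n; set L := ln n%:R; cbv zeta.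
have L1 : 1 <= L by rewrite /L; near: n; exact: near_ln_ge.
have gL0 : 0 <= g * L by rewrite mulr_ge0//; lra.
(* Beyond this threshold the additive constants of [scale_le] add at most [q1 - q] to the phase. *)
have Lbig : sigma * h%:R * (ln 2 / ln B + 1) / (q1 - q) <= L.
  by rewrite /L; near: n; exact: near_ln_ge.
set N := (Num.truncn _).+1; set J := scale (g * L).
have KJ : (K <= J)%N by rewrite /J /L; near: n; exact: near_scale.
have J0J : (J0 <= J)%N by rewrite /J /L; near: n; exact: near_scale.
have JB := scale_le gL0; rewrite -/J in JB.
(* The successor in [N] is absorbed by the factor 2 built into [scale]. *)
have NJ : N%:R <= B ^+ J.
  apply: le_trans (scale_cover gL0); rewrite /N -[leLHS]natr1.
  have : (Num.truncn (expR (g * L)))%:R <= expR (g * L) by rewrite truncn_le expR_ge0.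
  have : 1 <= expR (g * L) by rewrite -expR0 ler_expR.
  by rewrite mulr_natl mulr2n => e1 /lerD; apply.
have L0 : 0 < L by exact: lt_le_trans L1.
have J1 : (0 < J)%N by [].
clearbody J; clearbody N; clearbody L.
have th0 : 0 < sigma / L by rewrite divr_gt0.
have pi0 := pi_gt0 R.
apply: (@kern_confined R w (fun z => s <= w z) (sigma / L) Y k N K (h * J)) => //.
- exact: ltW.
- by rewrite k0 ltW.
- move=> x sx y yY; have /andP[y0 y1] := yY.
  have wx : 0 < w x by have /andP[] := w01 x; lra.
  apply: le_trans (ler_wpM2l (ltW wx) (ktan _ yY)).
  rewrite [leRHS](mulrA (w x) rho) [w x * rho]mulrC ler_wpM2r ?drift_rho//.
  rewrite divr_ge0//; first by rewrite sin_ge0_pi// y0/=; lra.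
  by rewrite cos_ge0_pihalf//; apply/andP; split; lra.
- by rewrite muln_gt0 h0.
- apply: (@le_trans _ _ q1); last first.
    by rewrite -ler_pdivrMr//; lra.
  rewrite natrM.
  have sL : 0 <= sigma / L * h%:R by rewrite mulr_ge0// ltW.
  have := ler_wpM2l sL JB; rewrite mulrA => /le_trans; apply.
  rewrite ler_pdivrMr in Lbig; last by lra.
  rewrite (_ : _ * _ = q + sigma * h%:R * (ln 2 / ln B + 1) / L); last first.
    by rewrite qE; field; rewrite !gt_eqF.
  by rewrite -lerBrDl ler_pdivrMr// [leRHS]mulrC.
- move=> x xN1 xN2; apply: leq_trans KJ _; apply/ltnW/drifts0 => //.
  by apply: le_trans NJ; rewrite ler_nat (absz_window xN1 xN2).
Unshelve. all: by end_near. Qed.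

Let prod_le (s' : seq int) : \prod_(x <- s') ((1 - w x) / w x) <=
  rho ^+ count (fun z => s <= w z) s'.
Proof.
elim: s' => [|x s' IH]; first by rewrite big_nil.
have /andP[rho0 rho1] := rho01; have /andP[w0 w1] := w01 x.
have wx : 0 < w x by lra.
rewrite big_cons /= exprD; apply: ler_pM => //.
- by rewrite divr_ge0//; lra.
- rewrite big_seq; apply: prodr_ge0 => y _; have /andP[? ?] := w01 y.
  by rewrite divr_ge0//; lra.
- case: (boolP (s <= w x)) => [/drift_rho|_]; first by rewrite expr1 ler_pdivrMr.
  by rewrite expr0 ler_pdivrMr//; lra.
Qed.

(** A drift site contributes at most [rho], any other site at most 1, and each full block of length
    [h * J] holds at least [J] drift sites. The incomplete block loses at most [J], which is at most
    [C * ln n]. *)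
Lemma prod_path_to_le : exists2 C : R, 0 < C &
  \forall n \near \oo, forall z : int, (`|z| <= 2 * n)%N ->
    \prod_(x <- path_to z) ((1 - w x) / w x) <=
    expR (ln rho * (`|z|%N%:R / h%:R - C * ln n%:R)).
Proof.
have hR : (0 : R) < h%:R by rewrite ltr0n.
have /andP[rho0 rho1] := rho01.
have lrho : ln rho <= 0 by rewrite ln_le0// ltW.
have ln2 : 0 <= ln (2 : R) by rewrite ln_ge0// ler1n.
exists ((1 + ln 2) / ln B + 1); first by rewrite ltr_wpDl// divr_ge0 ?addr_ge0// ltW.
have [J0 _ drifts0] := drifts.
near=> n; move=> z zn; set L := ln n%:R.
have nE : expR L = n%:R by rewrite /L; near: n; exact: near_expR_ln.
have L1 : 1 <= L by rewrite /L; near: n; exact: near_ln_ge.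
have L0 : 0 <= L by lra.
set J := scale (1 * L).
have J0J : (J0 <= J)%N by rewrite /J /L; near: n; exact: near_scale.
have nJ : (2 * n)%N%:R <= B ^+ J.
  by rewrite natrM -nE /J mul1r; exact: scale_cover.
have JL : J%:R <= ((1 + ln 2) / ln B + 1) * L.
  have := scale_le L0; rewrite /J mul1r => /le_trans; apply.
  rewrite [leRHS]mulrDl mul1r lerD// mulrAC ler_wpM2r ?invr_ge0 ?(ltW lB)//.
  rewrite mulrDl mul1r lerD2l; exact: ler_peMr.
have J1 : (0 < J)%N by [].
clearbody J; clearbody L.
have cnt : (`|z| %/ (h * J) * J <= count (fun u => (s <= w u)%R) (path_to z))%N.
  apply: count_path_to => y yz; apply/ltnW/drifts0 => //.
  by apply: le_trans nJ; rewrite ler_nat (leq_trans yz).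
apply: le_trans (prod_le _) _.
apply: (@le_trans _ _ (rho ^+ (`|z| %/ (h * J) * J))).
  by apply: ler_wiXn2l => //; exact: ltW.
rewrite (exprn_expR _ rho0) ler_expR mulrC ler_wnM2l//.
apply: (@le_trans _ _ (`|z|%N%:R / h%:R - J%:R)); first by rewrite lerB.
rewrite lerBlDr ler_pdivrMr// -natrD -natrM ler_nat.
by apply: leq_blocks; rewrite muln_gt0 h0.
Unshelve. all: by end_near. Qed.

End drift_asymptotics.

(** The left side counts the pairs of [cond_prob_le_visits] at time [2 * n], times [c^-1]; 15 bounds
    the sum of the coefficients of [8 n^2 + 6 n + 1]. *)
Lemma polynomial_le_expR (R : realType) (c L : R) (n : nat) :
  0 < c -> 1 <= L -> expR L = n%:R ->
  ((2 * n).+1 * (2 * n).*2.+1)%:R * c^-1 <=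
  expR ((ln 15 + `|ln c| + 2) * L).
Proof.
move=> c0 L1 nE.
have n1 : 1 <= n%:R :> R.
  by rewrite -nE -expR0 ler_expR (le_trans _ L1).
apply: (@le_trans _ _ (15 * n%:R ^+ 2 * c^-1)).
  rewrite ler_wpM2r ?invr_ge0 ?(ltW c0)//.
  rewrite (_ : (_ * _)%:R = (2 * n%:R + 1) * (4 * n%:R + 1)); last first.
    by rewrite natrM -!natr1 -muln2 !natrM; ring.
  have : n%:R <= n%:R ^+ 2 :> R by rewrite expr2 ler_peMr// (le_trans ler01).
  by move: (n%:R : R) n1 => x x1 xx; rewrite (_ : _ * _ = 8 * x ^+ 2 + 6 * x + 1);
    [lra|ring].
have -> : 15 * n%:R ^+ 2 * c^-1 = expR (ln 15 - ln c + 2 * L).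
  by rewrite 2!expRD expRN expRM_natl !lnK ?posrE// nE mulrAC.
rewrite ler_expR; have := ler_norm (- ln c); rewrite normrN => lc.
have l15 : 0 <= ln (15 : R) by rewrite ln_ge0// ler1n.
have : ln 15 + `|ln c| <= (ln 15 + `|ln c|) * L by rewrite ler_peMr ?addr_ge0.
by rewrite mulrDl; lra.
Qed.

(** Both sides are separated by [(1 + x ^+ 2)^-1], which is at most [1 - x ^+ 2 / 2] when
    [x ^+ 2 <= 1]. *)
Lemma expRN_sqr_le_cos (R : realType) (x : R) : 0 <= x <= 1 ->
  expR (- x ^+ 2) <= cos x.
Proof.
move=> /andP[x0 x1]; apply: le_trans (cos_ge_quadratic x).
have xx1 : x ^+ 2 <= 1 by rewrite expr_le1.
have xx0 : 0 <= x ^+ 2 by rewrite exprn_ge0.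
rewrite expRN; apply: (@le_trans _ _ (1 + x ^+ 2)^-1).
  by rewrite lef_pV2 ?posrE ?expR_gt0 ?expR_ge1Dx//; lra.
rewrite -[leLHS]mul1r ler_pdivrMr; last by lra.
move: (x ^+ 2) xx0 xx1 => y y0 y1.
have : 0 <= y * (1 - y) by rewrite mulr_ge0//; lra.
by lra.
Qed.

(** * The two limits in a fixed good environment *)

Section quenched_displacement.
Variables (R : realType) (w : environment R) (c A : R).
Hypotheses (c0 : 0 < c) (wc : forall x, 2^-1 <= w x <= 1 - c).
Hypotheses (A1 : 1 < A) (fair : fair_stretches w A).
Variables (s : R) (h : nat) (B : R).
Hypotheses (s01 : 2^-1 < s < 1) (h0 : (0 < h)%N) (B1 : 1 < B).
Hypothesis drifts : many_drifts w s h B.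

Let w01 x : 2^-1 <= w x <= 1.
Proof. by have := c0; have /andP[w1 w2] := wc x; rewrite w1/=; lra. Qed.

Let L n : R := ln n%:R.
Let S n : R := n%:R / L n ^+ 2.

Let near_S (k : R) : \forall n \near \oo, k * L n <= S n.
Proof.
near=> n.
have nE : expR (L n) = n%:R by near: n; exact: near_expR_ln.
have L1 : 1 <= L n by near: n; exact: near_ln_ge.
have : k * L n ^+ 3 <= expR (1 * L n) by near: n; exact: near_ln_dominated.
rewrite mul1r nE /S ler_pdivlMr; last by rewrite exprn_gt0// (lt_le_trans _ L1).
by rewrite exprS mulrA mulrAC.
Unshelve. all: by end_near. Qed.

Let expR_vanish (e : R) : 0 < e -> \forall n \near \oo, expR (- L n) <= e.
Proof.
move=> e0; near=> n; rewrite -[leRHS]lnK ?posrE// ler_expR lerNl.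
by near: n; exact: near_ln_ge.
Unshelve. all: by end_near. Qed.

Lemma near_powR_quotient (beta k : R) : beta < 2 ->
  \forall n \near \oo, k * S n <= n%:R / L n `^ beta.
Proof.
move=> beta2; near=> n.
have L1 : 1 <= L n by near: n; exact: near_ln_ge.
have L0 : 0 < L n by rewrite (lt_le_trans _ L1).
pose k1 := Num.max k 1.
have k10 : 0 <= k1 by rewrite le_max ler01 orbT.
have kL : k1 `^ (2 - beta)^-1 <= L n by near: n; exact: near_ln_ge.
have b0 : 0 <= 2 - beta by rewrite subr_ge0 ltW.
have : k1 <= L n `^ (2 - beta).
  have := ge0_ler_powR b0 (_ : _ \in Num.nneg) (_ : _ \in Num.nneg) kL.
  rewrite -powRrM mulVf ?subr_eq0 ?gt_eqF// powRr1//; apply; rewrite nnegrE ?powR_ge0//.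
  exact: ltW.
rewrite powRB ?(gt_eqF L0) ?implybT// powR_mulrn ?(ltW L0)// => kk.
have : k <= L n ^+ 2 / L n `^ beta by apply: le_trans kk; rewrite le_max lexx.
have Sn0 : 0 <= S n by rewrite divr_ge0// exprn_ge0// ltW.
move=> /(ler_wpM2r Sn0) /le_trans; apply.
rewrite le_eqVlt; apply/orP; left; apply/eqP; rewrite /S; field.
by rewrite (gt_eqF L0) gt_eqF// powR_gt0.
Unshelve. all: by end_near. Qed.

Lemma displacement_upper (beta : R) : beta < 2 ->
  forall (d : measure_display) (T : measurableType d)
    (Q : probability T R) (X : nat -> {mfun T >-> int}),
  quenched_walk w Q X ->
  cond_prob Q
    [set t | (max_abs X (2 * n) t)%:R >= n%:R / (ln n%:R `^ beta) :> R]
    [set t | X (2 * n)%N t = 0] @[n --> \oo] --> (0 : R).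
Proof.
move=> beta2 d T Q X XQ; apply/cvgr0Pnorm_le => e e0.
have lA : 0 < ln A by exact: ln_gt0.
(* Half the critical value: the constant in the lower bound is immaterial here. *)
pose tau := (2 * ln A)^-1.
have tau0 : 0 < tau by rewrite invr_gt0 mulr_gt0.
have tauA : tau * ln A < 1.
  by rewrite /tau invfM mulrVK ?unitfE ?gt_eqF// invf_lt1 ?ltr1n.
have [C C0 paths] := prod_path_to_le w01 s01 h0 B1 drifts.
pose la := - ln ((1 - s) / s).
have la0 : 0 < la.
  have /andP[s1 s2] := s01; have sp : 0 < s by rewrite (lt_trans _ s1).
  rewrite oppr_gt0 ln_lt0// divr_gt0 ?subr_gt0//= ltr_pdivrMr//.
  by rewrite mul1r; lra.
pose q := pi / 2 / tau.
have pi0 := pi_gt0 R.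
have q0 : 0 < q by rewrite !divr_gt0.
(* [k1 * L n] collects the polynomial factor and the loss from [C]. Of [k2], the part
   [1 + 2 * q ^+ 2] pays for the lower bound, one unit for [k1 * L n <= S n], and one leaves the
   factor [expR (- L n)]. *)
pose k1 := ln 15 + `|ln c| + 2 + la * C.
pose k2 := 3 + 2 * q ^+ 2.
have lower := kern_return_lower_bound c0 wc A1 fair tau0 tauA ltr01.
near=> n.
have nE : expR (L n) = n%:R by near: n; exact: near_expR_ln.
have L1 : 1 <= L n by near: n; exact: near_ln_ge.
have L0 : 0 < L n by rewrite (lt_le_trans _ L1).
have Lq : q <= L n by near: n; exact: near_ln_ge.
have low : expR (- (1 * S n)) * cos (q / L n) ^+ (2 * n) <=
    kern w (fun x => 1 - w x) (2 * n) 0 0 by near: n; exact: lower.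
have path z : (`|z| <= 2 * n)%N ->
    \prod_(x <- path_to z) ((1 - w x) / w x) <=
    expR (- la * (`|z|%N%:R / h%:R - C * L n)).
  by move: z; near: n; rewrite /la opprK; exact: paths.
have far : (k2 * h%:R / la) * S n <= n%:R / L n `^ beta.
  by near: n; exact: near_powR_quotient.
have k1S : k1 * L n <= S n by near: n; exact: near_S.
have LS : 1 * L n <= S n by near: n; exact: near_S.
have Le : expR (- L n) <= e by near: n; exact: expR_vanish.
rewrite ger0_norm; last exact: cond_prob_ge0.
apply: le_trans Le.
have hR : (0 : R) < h%:R by rewrite ltr0n.
pose E := expR (- la * ((k2 / la) * S n - C * L n)).
apply: (@le_trans _ _ _ _ _ (cond_prob_le_visits XQ c0 wc (_ : 0 <= E) _)).
- exact: expR_ge0.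
- move=> z rz zn; apply: le_trans (path z zn) _.
  rewrite ler_expR ler_nM2l ?oppr_lt0// lerD2r ler_pdivlMr//.
  by apply: le_trans rz; apply: le_trans far; rewrite mulrAC [_ * h%:R / la]mulrAC.
have low2 : expR (- (S n + 2 * q ^+ 2 * S n)) <=
    kern w (fun x => 1 - w x) (2 * n) 0 0.
  apply: le_trans low; rewrite opprD expRD mul1r ler_wpM2l ?expR_ge0//.
  have qL : 0 <= q / L n <= 1 by rewrite divr_ge0 ?(ltW q0) ?(ltW L0)//= ler_pdivrMr// mul1r.
  rewrite (_ : - _ = (2 * n)%N%:R * - (q / L n) ^+ 2); last first.
    by rewrite natrM /S; field; rewrite gt_eqF.
  rewrite expRM_natl; apply: lerXn2r; rewrite ?nnegrE ?expR_ge0 ?expRN_sqr_le_cos//.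
  by apply: le_trans (expRN_sqr_le_cos qL); exact: expR_ge0.
have p00 : 0 < kern w (fun x => 1 - w x) (2 * n) 0 0.
  exact: lt_le_trans (expR_gt0 _) low2.
rewrite ler_pdivrMr// mulrA.
apply: le_trans (ler_wpM2l (expR_ge0 _) low2).
apply: le_trans (ler_wpM2r (expR_ge0 _) (polynomial_le_expR c0 L1 nE)) _.
rewrite -!expRD ler_expR.
have -> : - la * (k2 / la * S n - C * L n) = la * C * L n - k2 * S n.
  by field; rewrite gt_eqF.
by move: k1S LS; rewrite /k1 /k2 !mulrDl !mul1r; lra.
Unshelve. all: by end_near. Qed.

Lemma displacement_lower (g : R) : g * ln A * h%:R < ln B ->
  0 < g ->
  forall gamma, gamma <= g ->
  forall (d : measure_display) (T : measurableType d)
    (Q : probability T R) (X : nat -> {mfun T >-> int}),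
  quenched_walk w Q X ->
  cond_prob Q
    [set t | (max_abs X (2 * n) t)%:R >= n%:R `^ gamma :> R]
    [set t | X (2 * n)%N t = 0] @[n --> \oo] --> (1 : R).
Proof.
move=> gAB g0 gamma gammag d T Q X XQ; apply/cvgrPdist_le => e e0.
have lA : 0 < ln A by exact: ln_gt0.
have pi0 := pi_gt0 R.
have hR : (0 : R) < h%:R by rewrite ltr0n.
have gh0 : 0 < g * h%:R by rewrite mulr_gt0.
(* [u / ln n] and [v / ln n] are the critical angles of the lower bound and of the confined bound;
   the hypothesis on [g] says exactly [u < v]. *)
pose u := pi / 2 * ln A; pose v := pi / 2 * ln B / (g * h%:R).
have u0 : 0 < u by rewrite mulr_gt0 ?divr_gt0.
have uv : u < v.
  rewrite /u /v ltr_pdivlMr// -(mulrA (pi / 2)) ltr_pM2l ?divr_gt0//.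
  by rewrite mulrA [ln A * g]mulrC.
pose q := u + (v - u) / 3; pose sigma := u + (v - u) * 2 / 3.
have uq : u < q by rewrite /q; lra.
have qs : q < sigma by rewrite /q /sigma; lra.
have sv : sigma < v by rewrite /sigma; lra.
have q0 : 0 < q by exact: lt_trans u0 uq.
have s0 : 0 < sigma by exact: lt_trans q0 qs.
pose tau := pi / 2 / q.
have tau0 : 0 < tau by rewrite !divr_gt0.
have tauA : tau * ln A < 1 by rewrite /tau mulrAC ltr_pdivrMr// mul1r.
have qE : pi / 2 / tau = q.
  by rewrite /tau invf_div mulrCA divff ?mulr1// gt_eqF ?divr_gt0.
have sgh : sigma * g * h%:R < pi / 2 * ln B.
  by rewrite -mulrA -ltr_pdivlMr.
(* By [cos_gap] the confined walk loses a factor [expR (- (k / L n ^+ 2))] per step, hence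
   [expR (- (2 * (k * S n)))] in all; half of this exponent compensates the error in the lower
   bound. *)
pose k := q / 2 * (sigma - q).
have k0 : 0 < k by rewrite mulr_gt0 ?divr_gt0 ?subr_gt0.
have lower := kern_return_lower_bound c0 wc A1 fair tau0 tauA k0.
rewrite qE in lower.
have upper := kern_confined_upper_bound w01 s01 h0 B1 drifts g0 s0 sgh.
have kE : k = q / 2 * (sigma - q) by [].
clearbody q sigma k.
near=> n.
have nE : expR (L n) = n%:R by near: n; exact: near_expR_ln.
have L1 : 1 <= L n by near: n; exact: near_ln_ge.
have L0 : 0 < L n by rewrite (lt_le_trans _ L1).
have Ls : sigma <= L n by near: n; exact: near_ln_ge.
have low : expR (- (k * S n)) * cos (q / L n) ^+ (2 * n) <=
    kern w (fun x => 1 - w x) (2 * n) 0 0 by near: n; exact: lower.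
set N := (Num.truncn (expR (g * L n))).+1.
have up : kern (killed N w) (killed N (fun x => 1 - w x)) (2 * n) 0 0 <=
    cos (sigma / L n) ^+ (2 * n) by rewrite /N; near: n; exact: upper.
have LS : k^-1 * L n <= S n by near: n; exact: near_S.
have Le : expR (- L n) <= e by near: n; exact: expR_vanish.
have N_large m : m%:R < n%:R `^ gamma -> (m < N)%N.
  move=> mn; rewrite /N ltnS truncn_ge_nat ?expR_ge0//.
  rewrite (le_trans (ltW mn))// mulrC expRM nE ler_powR//.
  by rewrite -nE -expR0 ler_expR ltW.
clearbody N.
have nR : 0 < n%:R :> R by rewrite -nE expR_gt0.
have p00 : 0 < kern w (fun x => 1 - w x) (2 * n) 0 0.
  apply: lt_le_trans low; rewrite mulr_gt0 ?expR_gt0// exprn_gt0//.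
  apply: cos_gt0_pihalf; rewrite (@lt_le_trans _ _ 0) ?oppr_lt0 ?divr_gt0 ?divr_ge0 ?(ltW q0) ?(ltW L0)//=.
  rewrite (@lt_le_trans _ _ 1) ?pihalf_ge1// ltr_pdivrMr// mul1r.
  exact: lt_le_trans qs Ls.
have small : kern (killed N w) (killed N (fun x => 1 - w x)) (2 * n) 0 0 <=
    expR (- L n) * kern w (fun x => 1 - w x) (2 * n) 0 0.
  apply: le_trans up _; apply: le_trans (ler_wpM2l (expR_ge0 _) low).
  set a := cos (q / L n); have sL1 : sigma / L n <= 1 by rewrite ler_pdivrMr// mul1r.
  have qL0 : 0 <= q / L n by rewrite divr_ge0// ltW.
  have qsL : q / L n <= sigma / L n by rewrite ler_pM2r ?invr_gt0// ltW.
  have gap := cos_gap qL0 qsL sL1; rewrite -/a in gap.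
  have a0 : 0 <= a.
    rewrite cos_ge0_pihalf// (le_trans _ qL0) ?oppr_le0 ?divr_ge0 ?(ltW pi0)//=.
    by rewrite (le_trans qsL)// (le_trans sL1)// pihalf_ge1.
  have b0 : 0 <= cos (sigma / L n).
    rewrite cos_ge0_pihalf// (le_trans _ (le_trans qL0 qsL)) ?oppr_le0 ?divr_ge0 ?(ltW pi0)//=.
    by rewrite (le_trans sL1)// pihalf_ge1.
  have ba : cos (sigma / L n) <= expR (- (k / L n ^+ 2)) * a.
    apply: (@le_trans _ _ ((1 - k / L n ^+ 2) * a)); last first.
      by rewrite ler_wpM2r// expR_ge1Dx.
    have -> : k / L n ^+ 2 = q / L n / 2 * (sigma / L n - q / L n).
      by rewrite kE; field; rewrite gt_eqF.
    move: gap; set z := _ * _ => gap.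
    have z0 : 0 <= z by rewrite mulr_ge0 ?subr_ge0// divr_ge0.
    have : z * a <= z by rewrite ler_piMr// cos_le1.
    by rewrite mulrBl mul1r; lra.
  apply: (@le_trans _ _ ((expR (- (k / L n ^+ 2)) * a) ^+ (2 * n))).
    by apply: lerXn2r; rewrite ?nnegrE// mulr_ge0 ?expR_ge0.
  rewrite exprMn mulrA ler_wpM2r ?exprn_ge0// -expRM_natl -expRD ler_expR.
  have -> : (2 * n)%N%:R * - (k / L n ^+ 2) = - (2 * (k * S n)).
    by rewrite natrM /S; ring.
  have : L n <= k * S n by rewrite -ler_pdivrMl.
  by lra.
have /andP[lo hi] := cond_prob_ge_confined XQ p00 N_large.
rewrite ger0_norm ?subr_ge0//; apply: le_trans Le; rewrite lerBlDr -lerBlDl.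
apply: le_trans lo; rewrite lerD2l lerN2 ler_pdivrMr//.
Unshelve. all: by end_near. Qed.

End quenched_displacement.

(** * Almost sure properties of the environment *)

Section borel_cantelli_geometric.
Context d (T : measurableType d) (R : realType) (P : probability T R).

(** Borel-Cantelli: the partial sums of the probabilities stay below [C / (1 - r)]. *)
Lemma ae_eventually_not (F : nat -> set T) (C r : R) :
  0 <= C -> 0 <= r < 1 -> (forall n, measurable (F n)) ->
  (forall n, fine (P (F n)) <= C * r ^+ n) ->
  {ae P, forall t, \forall n \near \oo, ~ F n t}.
Proof.
move=> C0 /andP[r0 r1] mF PF.
have PF0 : P (lim_sup_set F) = 0%E.
  apply: lim_sup_set_cvg0 => //.
  apply: (@le_lt_trans _ _ (C / (1 - r))%:E); last exact: ltry.
  apply: lime_le; first by apply: is_cvg_nneseries => n _ _; exact: measure_ge0.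
  apply: nearW => n.
  rewrite (eq_bigr (fun i => (fine (P (F i)))%:E)); last first.
    by move=> i _; rewrite fineK// fin_num_measure.
  rewrite sumEFin lee_fin; apply: (@le_trans _ _ (\sum_(0 <= i < n) C * r ^+ i)).
    exact: ler_sum.
  rewrite -mulr_sumr ler_wpM2l// -[leRHS]mul1r ler_pdivlMr ?subr_gt0//.
  rewrite big_mkord mulrC -opprB mulNr -subrX1 opprB.
  by rewrite gerBl exprn_ge0.
exists (lim_sup_set F); split=> //.
  by apply: bigcapT_measurable => n; apply: bigcup_measurable => k _; exact: mF.
move=> t /= nt n _; apply: contrapT => nF; apply: nt.
exists n => // k /= nk Fk; apply: nF; exists k => //.
Qed.

End borel_cantelli_geometric.

Section environment_law.
Variables (R : realType) (P : probability (env_space R) R).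
Hypothesis iid : iid_sites P.

Let p B : R := fine (P (env_event 0 B)).
Let pr (E : set (env_space R)) : R := fine (P E).

Let p_ge0 B : 0 <= p B. Proof. exact: fine_ge0. Qed.

Lemma measurable_env_event x B : measurable B -> measurable (@env_event R x B).
Proof. by move=> mB; apply: sub_sigma_algebra; exists x, B. Qed.

Definition all_sites (s : seq int) (B : set R) : set (env_space R) :=
  [set w | forall x, x \in s -> env_event x B w].

Lemma all_sites_cons x s B :
  all_sites (x :: s) B = env_event x B `&` all_sites s B.
Proof.
apply/seteqP; split=> [w aw|w [xw sw] y]; last by rewrite in_cons => /predU1P[->|/sw].
by split=> [|y ys]; apply: aw; rewrite in_cons ?eqxx// ys orbT.
Qed.

Lemma all_sites_cat s s' B :
  all_sites (s ++ s') B = all_sites s B `&` all_sites s' B.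
Proof.
elim: s => [|x s IHs]; last by rewrite cat_cons !all_sites_cons IHs setIA.
by rewrite cat0s (_ : all_sites [::] B = setT) ?setTI//; apply/seteqP; split.
Qed.

Lemma measurable_all_sites s B : measurable B -> measurable (all_sites s B).
Proof.
move=> mB; elim: s => [|x s IHs]; last first.
  by rewrite all_sites_cons; apply: measurableI => //; exact: measurable_env_event.
by rewrite (_ : all_sites [::] B = setT)//; apply/seteqP; split.
Qed.

Lemma prob_all_sites s B : uniq s -> measurable B ->
  pr (all_sites s B) = p B ^+ size s.
Proof.
move=> us mB; have PE r : uniq r ->
    P (all_sites r B) = (\prod_(x <- r) P (env_event x B))%E.
  by move=> ur; exact: (iid.1 r (fun=> B) ur (fun=> mB)).
elim: s us => [|x s IHs] us; first by rewrite /pr PE// big_nil.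
rewrite /pr PE// big_cons -PE; last by case/andP: us.
rewrite fineM ?fin_num_measure//; [|exact: measurable_env_event|exact: measurable_all_sites].
rewrite exprS -IHs; last by case/andP: us.
by rewrite /p (iid.2 x 0 B mB).
Qed.

Let pr_split E F : measurable E -> measurable F ->
  pr E = pr (E `\` F) + pr (E `&` F).
Proof.
move=> mE mF; rewrite /pr (measureDI P mE mF) fineD// fin_num_measure//.
  exact: measurableD.
exact: measurableI.
Qed.

Let pr_le E F : measurable E -> measurable F -> E `<=` F -> pr E <= pr F.
Proof.
by move=> mE mF EF; rewrite /pr fine_le ?fin_num_measure// le_measure ?inE.
Qed.

(** [iid_sites] speaks of intersections of site events only. Complements are removed block by block
    by subtraction, and [r] carries the sites already forced into [B]. *)
Lemma prob_no_block B (bs : seq (seq int)) (r : seq int) (l : nat) :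
  measurable B -> uniq (r ++ flatten bs) -> all (fun b => size b == l) bs ->
  pr (all_sites r B `&` [set w | forall b, b \in bs -> ~ all_sites b B w]) =
  p B ^+ size r * (1 - p B ^+ l) ^+ size bs.
Proof.
move=> mB; pose none (bs : seq (seq int)) := [set w | forall b, b \in bs -> ~ all_sites b B w].
have none_cons b bs' : none (b :: bs') = none bs' `\` all_sites b B.
  apply/seteqP; split=> [w nw|w [nw nb] b'].
    by split=> [b' b's|]; apply: nw; rewrite in_cons ?eqxx// b's orbT.
  by rewrite in_cons => /predU1P[->//|/nw].
have mnone bs' : measurable (none bs').
  elim: bs' => [|b bs' IH]; last by rewrite none_cons; apply: measurableD => //; exact: measurable_all_sites.
  by rewrite (_ : none [::] = setT)//; apply/seteqP; split.
have mall r' := measurable_all_sites r' mB.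
elim: bs r => [|b bs IHbs] r /=.
  rewrite cats0 mulr1 => ur _; rewrite (_ : mkset _ = setT) ?setIT ?prob_all_sites//.
  by apply/seteqP; split.
move=> ur /andP[/eqP bl bsl]; rewrite -/(none (b :: bs)) none_cons setIDA.
have ur1 : uniq (r ++ flatten bs).
  by move: ur; rewrite !cat_uniq has_cat negb_or => /and3P[-> /andP[_ ->]] /and3P[_ _ ->].
have ur2 : uniq ((r ++ b) ++ flatten bs) by rewrite -catA.
have := pr_split (measurableI _ _ (mall r) (mnone bs)) (mall b).
rewrite setIAC -all_sites_cat IHbs// IHbs// size_cat bl.
move=> /esym/(canRL (addrK _)) ->; rewrite exprS exprD; ring.
Qed.

Section few_drifts.
Variable s : R.
Let low : set R := [set` `]-oo, s[].
Let few (r : seq int) (k : nat) : set (env_space R) :=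
  [set w | (count (fun x => s <= (w : environment R) x)%R r <= k)%N].

Let lowE x (w : environment R) : env_event x low w <-> ~~ (s <= w x).
Proof. by rewrite /env_event /low /= in_itv /= -ltNge. Qed.

Let few_low x r k : env_event x low `&` few (x :: r) k = env_event x low `&` few r k.
Proof.
by apply/seteqP; split=> w [xw]; move: (xw) => /lowE/negbTE; rewrite /few /= => ->.
Qed.

Let few_high x r k : few (x :: r) k `\` env_event x low =
  (if k is k'.+1 then few r k' else set0) `\` env_event x low.
Proof.
have h w : ~ env_event x low w -> s <= w x by move=> /lowE/negP; rewrite negbK.
by apply/seteqP; split=> w [fw xw]; split=> //; move: fw; rewrite /few /= (h _ xw); case: k.
Qed.

Let mlow x : measurable (@env_event R x low).
Proof. by apply: measurable_env_event; exact: measurable_itv. Qed.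

Lemma measurable_few_drifts r k : measurable (few r k).
Proof.
elim: r k => [|x r IHr] k; first by rewrite (_ : few _ _ = setT)//; apply/seteqP; split.
rewrite -(setUIDK (few (x :: r) k) (env_event x low)) few_high setIC few_low.
by apply: measurableU; [exact: measurableI|apply: measurableD => //; case: k].
Qed.

(** An exponential Chebyshev bound with weight [t] per drift site, run as an induction on the list;
    [a] collects the sites already known to be low. *)
Lemma prob_few_drifts (t : R) r k : 0 < t <= 1 -> uniq r ->
  pr (few r k) <= t^-1 ^+ k * (p low + t) ^+ size r.
Proof.
move=> /andP[t0 t1] ur; suff gen a : uniq (a ++ r) ->
    pr (all_sites a low `&` few r k) <= p low ^+ size a * (t^-1 ^+ k * (p low + t) ^+ size r).
  have := gen [::] ur; rewrite mul1r (_ : all_sites [::] low = setT) ?setTI//.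
  by apply/seteqP; split.
have ti : 1 <= t^-1 by rewrite invf_ge1.
have ti0 : 0 <= t^-1 by rewrite (le_trans ler01).
have qt : 0 <= p low + t by rewrite addr_ge0// ltW.
have mlo : measurable low by exact: measurable_itv.
elim: r k a {ur} => [|x r IHr] k a.
  rewrite cats0 mulr1 => ua; rewrite (_ : few _ _ = setT) ?setIT; last by apply/seteqP; split.
  by rewrite prob_all_sites// ler_peMr ?exprn_ge0// exprn_ege1.
move=> uaxr.
have uxa : uniq ((x :: a) ++ r) by move: uaxr; rewrite -cat1s uniq_catCA.
have ua : uniq (a ++ r) by case/andP: uxa.
have mE b k' r' : measurable (all_sites b low `&` few r' k').
  by apply: measurableI; [exact: measurable_all_sites|exact: measurable_few_drifts].
rewrite (pr_split (mE _ _ _) (mlow x)).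
have -> : all_sites a low `&` few (x :: r) k `&` env_event x low =
    all_sites (x :: a) low `&` few r k.
  by rewrite -setIA [few _ _ `&` _]setIC few_low all_sites_cons setIA [_ `&` env_event _ _]setIC.
rewrite -setIDA few_high addrC.
(* A drift site at [x] uses up one unit of [k], which yields the factor [t]; its own probability is
   bounded by 1. *)
have high : pr (all_sites a low `&`
    ((if k is k'.+1 then few r k' else set0) `\` env_event x low)) <=
    p low ^+ size a * (t^-1 ^+ k * ((p low + t) ^+ size r * t)).
  case: k => [|k].
    by rewrite set0D setI0 /pr measure0 !mulr_ge0 ?exprn_ge0// ltW.
  rewrite exprSr -mulrA [t^-1 * _]mulrCA mulVf ?gt_eqF// mulr1.
  apply: le_trans (IHr k a ua); apply: pr_le => //.
    apply: measurableI; first exact: measurable_all_sites.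
    by apply: measurableD => //; exact: measurable_few_drifts.
  by move=> w [? []].
apply: le_trans (lerD (IHr k (x :: a) uxa) high) _.
rewrite /= !exprS le_eqVlt; apply/orP; left; apply/eqP; ring.
Qed.

End few_drifts.

Let union_sites (I : eqType) (E : seq I) (F : I -> set (env_space R)) :
  (forall i, measurable (F i)) ->
  measurable [set w | exists2 i, i \in E & F i w].
Proof.
move=> mF; elim: E => [|i E IHE].
  by rewrite (_ : mkset _ = set0)//; apply/seteqP; split=> // w [].
rewrite (_ : mkset _ = F i `|` [set w | exists2 i, i \in E & F i w]).
  exact: measurableU.
apply/seteqP; split=> [w [k]|w [Fi|[k kE Fk]]].
- by rewrite in_cons => /predU1P[->|kE] Fk; [left|right; exists k].
- by exists i => //; rewrite mem_head.
- by exists k => //; rewrite in_cons kE orbT.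
Qed.

(** None of the [M l > A ^+ l] disjoint blocks is fair with probability [(1 - al ^+ l) ^+ M l], at
    most [expR (- (al * A) ^+ l)], hence at most the summable [(al * A)^-1 ^+ l]. *)
Lemma ae_fair_stretches (A : R) : let al := p [set 2^-1] in
  0 < al -> 1 < al * A ->
  {ae P, forall w, fair_stretches (w : environment R) A}.
Proof.
cbv zeta; set al := p _ => al0 alA.
have mh : measurable [set (2^-1 : R)] by [].
have al1 : al <= 1.
  have := prob_all_sites (erefl : uniq [:: (0 : int)]) mh; rewrite expr1 -/al => <-.
  by rewrite /pr -lee_fin fineK ?probability_le1// ?fin_num_measure//; exact: measurable_all_sites.
have A0 : 0 < A by rewrite -(pmulr_rgt0 _ al0) (lt_trans _ alA).
pose M l := (Num.truncn (A ^+ l)).+1.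
(* Blocks start at [1 + i * l] because the stretch following [b] does not contain [b]. *)
pose bs l := [seq window (1 + (i * l)%N%:Z) l | i <- iota 0 (M l)].
have flat l m k : flatten [seq window (1 + (i * l)%N%:Z) l | i <- iota k m] =
    window (1 + (k * l)%N%:Z) (m * l).
  elim: m k => [//|m IHm] k; rewrite /= IHm (mulSn m) windowD; congr (_ ++ window _ _).
  by rewrite mulSn; lia.
pose F l := [set w | forall b, b \in bs l -> ~ all_sites b [set 2^-1] w].
have PF l : pr (F l) = (1 - al ^+ l) ^+ M l.
  have := @prob_no_block [set 2^-1] (bs l) [::] l mh.
  rewrite mul1r size_map size_iota (_ : all_sites [::] _ = setT) ?setTI; last by apply/seteqP; split.
  apply; first by rewrite cat0s flat window_uniq.
  by apply/allP => b /mapP[i _ ->]; rewrite size_window.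
have mF l : measurable (F l).
  rewrite (_ : F l = ~` [set w | exists2 b, b \in bs l & all_sites b [set 2^-1] w]).
    by apply: measurableC; apply: union_sites => b; exact: measurable_all_sites.
  apply/seteqP; split=> [w Fw [b bb]|w nw b bb ab]; first exact: Fw.
  by apply: nw; exists b.
have r01 : 0 <= (al * A)^-1 < 1.
  by rewrite invr_ge0 (le_trans ler01 (ltW alA)) invf_lt1// (lt_trans _ alA).
have PFle l : fine (P (F l)) <= 1 * (al * A)^-1 ^+ l.
  rewrite -/(pr _) PF mul1r.
  have y0 : 0 <= al ^+ l by rewrite exprn_ge0// ltW.
  have y1 : al ^+ l <= 1 by rewrite exprn_ile1// ltW.
  apply: (@le_trans _ _ (expR (- al ^+ l) ^+ M l)).
    by apply: lerXn2r; rewrite ?nnegrE ?expR_ge0 ?expR_ge1Dx ?subr_ge0.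
  rewrite -expRM_natl mulrN expRN exprVn lef_pV2 ?posrE ?expR_gt0 ?exprn_gt0//; last first.
    by rewrite (lt_trans _ alA).
  apply: (@le_trans _ _ ((M l)%:R * al ^+ l)); last first.
    by apply: le_trans (expR_ge1Dx _); rewrite lerDr.
  rewrite exprMn mulrC ler_wpM2r// /M.
  by have /truncn_itv/andP[_ /ltW] : 0 <= A ^+ l by rewrite exprn_ge0// ltW.
apply: filterS (ae_eventually_not ler01 r01 mF PFle) => w Fw.
near=> l.
have : ~ F l w by near: l; exact: Fw.
move=> /existsNP[b] /not_implyP[/mapP[i]]; rewrite mem_iota add0n => iM -> /contrapT ab.
exists (i * l)%N.
  rewrite natrM mulrC ler_wpM2l// (@le_trans _ _ (Num.truncn (A ^+ l))%:R)// ?ler_nat//.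
  by rewrite (@le_trans _ _ (A ^+ l)) ?truncn_le ?exprn_ge0 ?(ltW A0)// lerDl.
move=> x xi; apply: ab; rewrite mem_window; lia.
Unshelve. all: by end_near. Qed.

(** At most [3 * B ^+ j] starting points, each bad with probability at most
    [t^-1 ^+ j * v ^+ (h * j)], give a geometric series of ratio [B * v ^+ h / t]. *)
Lemma ae_many_drifts (s t B : R) (h : nat) :
  0 < t <= 1 -> 1 < B -> B * (p [set` `]-oo, s[] + t) ^+ h / t < 1 ->
  {ae P, forall w, many_drifts (w : environment R) s h B}.
Proof.
move=> t01 B1; set v := p _ + t => small; have /andP[t0 t1] := t01.
have v0 : 0 <= v by rewrite addr_ge0// ltW.
have B0 : 0 <= B by rewrite ltW// (lt_trans _ B1).
pose starts j : seq int :=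
  window (- (Num.truncn (B ^+ j))%:Z) (Num.truncn (B ^+ j)).*2.+1.
pose few j x : set (env_space R) := [set w |
  (count (fun y => s <= (w : environment R) y)%R (window x (h * j)) <= j)%N].
have mfew j x : measurable (few j x) by exact: measurable_few_drifts.
pose F j := [set w | exists2 x, x \in starts j & few j x w].
have mF j : measurable (F j) by exact: union_sites.
have r01 : 0 <= B * v ^+ h / t < 1.
  by rewrite small andbT divr_ge0 ?(ltW t0)// mulr_ge0// exprn_ge0.
have PF j : fine (P (F j)) <= 3 * (B * v ^+ h / t) ^+ j.
  have Pfew x : x \in starts j -> fine (P (few j x)) <= t^-1 ^+ j * v ^+ (h * j).
    have := prob_few_drifts s j t01 (window_uniq x (h * j)).
    by rewrite size_window.
  apply: le_trans (union_bound (mF j) (mfew j) (fun w Fw => Fw) Pfew) _.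
  rewrite size_window.
  have -> : 3 * (B * v ^+ h / t) ^+ j = 3 * B ^+ j * (t^-1 ^+ j * v ^+ (h * j)).
    by rewrite !exprMn exprM; ring.
  rewrite ler_wpM2r ?mulr_ge0 ?exprn_ge0 ?invr_ge0 ?(ltW t0)//.
  have Bj : 1 <= B ^+ j by rewrite exprn_ege1// ltW.
  have : (Num.truncn (B ^+ j))%:R <= B ^+ j by rewrite truncn_le exprn_ge0.
  by rewrite -natr1 -muln2 natrM; lra.
apply: filterS (ae_eventually_not (ler0n _ 3) r01 mF PF) => w Fw.
near=> j; move=> x xB.
have nF : ~ F j w by near: j; exact: Fw.
rewrite ltnNge; apply/negP => fx; apply: nF; exists x => //.
have : (`|x| <= Num.truncn (B ^+ j))%N by rewrite truncn_ge_nat ?exprn_ge0.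
by rewrite mem_window; lia.
Unshelve. all: by end_near. Qed.

(** Continuity from above: the events that the value at 0 is below [u n] decrease to its being at
    most 1/2, which almost surely means equal to 1/2. *)
Lemma exists_drift_threshold (v : R) :
  P (env_event 0 [set` `[2^-1, +oo[]) = 1%E -> p [set 2^-1] < v ->
  exists2 s, 2^-1 < s < 1 & p [set` `]-oo, s[] < v.
Proof.
(* Starting the sequence at 1/3 keeps [u n] below 1. *)
move=> p1 pv; pose u n : R := 2^-1 + n.+3%:R^-1.
pose F n : set (env_space R) := env_event 0 [set` `]-oo, u n[].
have mF n : measurable (F n) by apply: measurable_env_event; exact: measurable_itv.
have uE n : 2^-1 < u n by rewrite /u ltrDl invr_gt0 ltr0n.
have u1 n : u n < 1.
  have : n.+3%:R^-1 <= 3^-1 :> R by rewrite lef_pV2 ?posrE ?ltr0n// ler_nat.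
  by rewrite /u; move: (n.+3%:R^-1) => z z3; lra.
have capF : \bigcap_n F n = env_event 0 [set` `]-oo, 2^-1]].
  apply/seteqP; split=> [w Fw|w + n _]; rewrite /F /env_event /= !in_itv /=.
    rewrite leNgt; apply/negP => wh.
    have e0 : 0 < (w : environment R) 0 - 2^-1 by rewrite subr_gt0.
    pose n := Num.truncn ((w : environment R) 0 - 2^-1)^-1.
    have := Fw n Logic.I; rewrite /F /env_event /= in_itv /= /u -ltrBlDl ltNge => /negP; apply.
    rewrite -[leRHS]invrK lef_pV2 ?posrE ?invr_gt0 ?ltr0n//.
    have /truncn_itv/andP[_ /ltW/le_trans] : 0 <= ((w : environment R) 0 - 2^-1)^-1.
      by rewrite invr_ge0 ltW.
    by apply; rewrite ler_nat -/n; lia.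
  by move=> wh; exact: le_lt_trans wh (uE n).
have mcap : measurable (\bigcap_n F n).
  by rewrite capF; apply: measurable_env_event; exact: measurable_itv.
have niF : nonincreasing_seq F.
  move=> m n mn; apply/subsetPset => w; rewrite /F /env_event /= !in_itv /= => /lt_le_trans; apply.
  by rewrite lerD2l lef_pV2 ?posrE ?ltr0n// ler_nat.
have Ffin : (P (F 0%N) < +oo)%E by rewrite ltey_eq fin_num_measure.
have cF : fine (P (F n)) @[n --> \oo] --> fine (P (\bigcap_n F n)).
  apply/fine_cvg; rewrite fineK ?fin_num_measure//.
  exact: (nonincreasing_cvg_mu Ffin mF mcap niF).
have pcap : fine (P (\bigcap_n F n)) < v.
  apply: le_lt_trans pv; rewrite capF.
  have mge : measurable (@env_event R 0 [set` `[2^-1, +oo[]).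
    by apply: measurable_env_event; exact: measurable_itv.
  have mle : measurable (@env_event R 0 [set` `]-oo, 2^-1]]).
    by apply: measurable_env_event; exact: measurable_itv.
  have mh : measurable (@env_event R 0 [set 2^-1]) by exact: measurable_env_event.
  have P0 : pr (~` env_event 0 [set` `[2^-1, +oo[]) = 0.
    by rewrite /pr probability_setC// p1 subee.
  rewrite -/(pr _) (pr_split mle mh) (_ : pr (_ `\` _) = 0) ?add0r.
    by apply: pr_le => //; exact: measurableI.
  apply/eqP; rewrite eq_le fine_ge0// andbT -P0; apply: pr_le => //.
  - exact: measurableD.
  - exact: measurableC.
  move=> w []; rewrite /env_event /= !in_itv /= andbT => wle wne wge.
  by apply: wne; apply/eqP; rewrite eq_le wle.
have [n _ Fn] := cvgr_lt _ cF _ pcap.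
by exists (u n); [rewrite uE u1|exact: (Fn n (leqnn n))].
Qed.

Lemma ae_site_bounds (c : R) :
  (forall x, P (env_event x [set` `[c, 1 - c]]) = 1%E) ->
  P (env_event 0 [set` `[2^-1, +oo[]) = 1%E ->
  {ae P, forall w, forall x, 2^-1 <= (w : environment R) x <= 1 - c}.
Proof.
move=> hc h2; have FP : Filter (almost_everywhere P) by exact: ae_filter_ringOfSetsType.
have ae1 x (B : set R) : measurable B -> P (env_event x B) = 1%E ->
    {ae P, forall w, B ((w : environment R) x)}.
  move=> mB PB; have mE := measurable_env_event x mB.
  exists (~` env_event x B); split; [exact: measurableC| |by []].
  by rewrite probability_setC// PB subee.
have both x : {ae P, forall w, 2^-1 <= (w : environment R) x <= 1 - c}.
  have mI1 : measurable ([set` `[2^-1, +oo[] : set R) by exact: measurable_itv.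
  have mI2 : measurable ([set` `[c, 1 - c]] : set R) by exact: measurable_itv.
  have P1 : P (env_event x [set` `[2^-1, +oo[]) = 1%E by rewrite (iid.2 x 0 _ mI1).
  by apply: filterS (filterI (ae1 x _ mI1 P1) (ae1 x _ mI2 (hc x))) => w []; rewrite /= !in_itv/= andbT => -> /andP[_ ->].
(* The integers are enumerated as [n] and [- n], so that a countable intersection over [nat]
   suffices. *)
have bothn : {ae P, forall w, forall n : nat,
    2^-1 <= (w : environment R) n%:Z <= 1 - c /\
    2^-1 <= (w : environment R) (- n%:Z) <= 1 - c}.
  by apply: ae_foralln => n; apply: filterI; exact: both.
apply: filterS bothn => w wn x; have [w1 w2] := wn `|x|%N.
by have [x0|x0] := leP 0 x; [move: w1|move: w2]; congr (_ <= w _ <= _); lia.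
Qed.

(* With [a = - ln alpha] and [eta = (1 - g) / 4], the scales are
   [ln A = a (1 + eta)] and [ln B / h = a (1 - 2 eta)]. *)
Lemma exists_scales (g : R) : 0 < g < 1 ->
  P (env_event 0 [set` `[2^-1, +oo[]) = 1%E ->
  (0 < P (env_event 0 [set 2^-1%R])%R < 1)%E ->
  exists A s h B, [/\ 1 < A, 2^-1 < s < 1, (0 < h)%N, 1 < B & g * ln A * h%:R < ln B] /\
    {ae P, forall w, fair_stretches (w : environment R) A} /\
    {ae P, forall w, many_drifts (w : environment R) s h B}.
Proof.
move=> /andP[g0 g1] hright halpha; set al := p [set 2^-1].
have mh : measurable (@env_event R 0 [set 2^-1]) by exact: measurable_env_event.
have /andP[al0 al1] : 0 < al < 1.
  by move: halpha; rewrite -(fineK (fin_num_measure P _ mh)) !lte_fin.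
pose a := - ln al; pose eta := (1 - g) / 4.
have a0 : 0 < a by rewrite oppr_gt0 ln_lt0// al0.
have eta0 : 0 < eta by rewrite /eta; lra.
have eta1 : g * (1 + eta) < 1 - 2 * eta.
  have : g * eta < eta by rewrite gtr_pMl.
  by rewrite mulrDr mulr1 /eta; lra.
have eta2 : 0 < 1 - 2 * eta by rewrite /eta; lra.
have alE : al = expR (- a) by rewrite opprK lnK ?posrE.
pose v := expR (- (a * (1 - eta))).
have alv : al < v.
  by rewrite alE ltr_expR ltrN2 gtr_pMr// /eta; lra.
have v1 : v < 1.
  by rewrite -expR0 ltr_expR oppr_lt0 mulr_gt0//; lra.
have [s s01 qv] := exists_drift_threshold hright alv.
pose t := v - p [set` `]-oo, s[].
have t0 : 0 < t by rewrite subr_gt0.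
have t1 : t <= 1 by have := p_ge0 [set` `]-oo, s[]; rewrite /t; lra.
(* With this [h], the ratio [B * v ^+ h / t] required below 1 equals
   [expR (- (a * eta)) ^+ h / t]. *)
have [||h hh] := @exprn_vanish R (expR (- (a * eta))) t => //.
  by rewrite expR_ge0 -expR0 ltr_expR oppr_lt0 mulr_gt0.
have h0 : (0 < h)%N.
  by rewrite lt0n; apply/eqP => h0; move: hh; rewrite h0 expr0 ltNge t1.
have hR : (0 : R) < h%:R by rewrite ltr0n.
exists (expR (a * (1 + eta))), s, h, (expR (h%:R * (a * (1 - 2 * eta)))).
have A1 : 1 < expR (a * (1 + eta)) by rewrite expR_gt1 mulr_gt0//; lra.
have B1 : 1 < expR (h%:R * (a * (1 - 2 * eta))) by rewrite expR_gt1 !mulr_gt0.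
split; [split=> //|split].
- rewrite !expRK mulrCA [h%:R * _]mulrC ltr_pM2r// ltr_pM2l//.
- apply: ae_fair_stretches => //; rewrite -/al alE -expRD expR_gt1.
  by rewrite mulrDr mulr1 addrA addNr add0r mulr_gt0.
- apply: (@ae_many_drifts s t) => //; first by rewrite t0.
  rewrite subrKC -expRM_natl -expRD ltr_pdivrMr// mul1r.
  by rewrite -mulrDr expRM_natl (_ : _ + _ = - (a * eta))//; ring.
Qed.

End environment_law.

Theorem theorem3p1 (R : realType) (P : probability (env_space R) R)
  (hiid : iid_sites P)
  (hell : exists2 c : R, 0 < c &
     forall x : int, P (env_event x [set` `[c, 1 - c]]) = 1%E)
  (hright : P (env_event 0 [set` `[2^-1, +oo[]) = 1%E)
  (halpha : (0 < P (env_event 0 [set 2^-1%R])%R < 1)%E) :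
  (forall beta : R, beta < 2 ->
     {ae P, forall w : environment R,
       forall (d : measure_display) (T : measurableType d)
         (Q : probability T R) (X : nat -> {mfun T >-> int}),
       quenched_walk w Q X ->
       cond_prob Q
         [set t | (max_abs X (2 * n) t)%:R >= n%:R / (ln n%:R `^ beta) :> R]
         [set t | X (2 * n)%N t = 0] @[n --> \oo] --> (0 : R)}) /\
  (forall gamma : R, gamma < 1 ->
     {ae P, forall w : environment R,
       forall (d : measure_display) (T : measurableType d)
         (Q : probability T R) (X : nat -> {mfun T >-> int}),
       quenched_walk w Q X ->
       cond_prob Q
         [set t | (max_abs X (2 * n) t)%:R >= n%:R `^ gamma :> R]
         [set t | X (2 * n)%N t = 0] @[n --> \oo] --> (1 : R)}).
Proof.
have FP : Filter (almost_everywhere P) by exact: ae_filter_ringOfSetsType.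
have [c c0 hc] := hell; have sites := ae_site_bounds hiid hc hright.
split=> [beta beta2|gamma gamma1].
  (* Any exponent in [(0, 1)] serves for the first limit; 1/2 is taken. *)
  have g01 := half_in01 R 0.
  have [A [s [h [B [[A1 s01 h0 B1 _] [fair drifts]]]]]] := exists_scales hiid g01 hright halpha.
  apply: filterS (filterI sites (filterI fair drifts)) => w [wc [wfair wdrifts]].
  exact: (displacement_upper c0 wc A1 wfair s01 h0 B1 wdrifts).
(* The maximum with 1/2 keeps the exponent positive even when [gamma] is not. *)
pose g := Num.max gamma 2^-1.
have g01 : 0 < g < 1.
  by have /andP[h0 h1] := half_in01 R 0; rewrite lt_max gt_max gamma1 h0 h1 orbT.
have [A [s [h [B [[A1 s01 h0 B1 gAB] [fair drifts]]]]]] := exists_scales hiid g01 hright halpha.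
have /andP[g0 _] := g01.
have gg : gamma <= g by rewrite le_max lexx.
apply: filterS (filterI sites (filterI fair drifts)) => w [wc [wfair wdrifts]].
exact: (displacement_lower c0 wc A1 wfair s01 h0 B1 wdrifts gAB g0 gg).
Qed.
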